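(* Let $X$, $Y$ be proper, smooth, geometrically connected curves over fields $k_X$, $k_Y$, with function fields $K_X$, $K_Y$ and sets of closed points $X^{\mathrm{cl}}$, $Y^{\mathrm{cl}}$, respectively. Let $E_X\subset X^{\mathrm{cl}}$, $E_Y\subset Y^{\mathrm{cl}}$ be finite subsets, and let $\phi:X^{\mathrm{cl}}-E_X\xrightarrow{\sim}Y^{\mathrm{cl}}-E_Y$ be a bijection of sets. Let $\iota:\mathcal O_{E_X}^{\times}\hookrightarrow\mathcal O_{E_Y}^{\times}$ be an embedding (injective homomorphism) of multiplicative groups which is order-preserving and value-preserving relative to $\phi$. Assume further that $X(k_X)$ is an infinite set. Then $\iota$ arises from a uniquely determined embedding of fields $K_X\hookrightarrow K_Y$ (i.e. there is a unique field embedding $K_X\hookrightarrow K_Y$ whose restriction to $\mathcal O_{E_X}^{\times}$ is $\iota$).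
   Context: $\mathcal O_{E_X}=\{f\in K_X\mid \operatorname{ord}_x(f)\ge 0\ \forall x\in E_X\}$, so $\mathcal O_{E_X}^{\times}=\{f\in K_X^{\times}\mid \operatorname{ord}_x(f)=0\ \forall x\in E_X\}$; similarly for $Y$. $k(x)$ denotes the residue field at a closed point $x$. $\iota$ is order-preserving relative to $\phi$ if for each $x\in X^{\mathrm{cl}}-E_X$ there is a positive integer $e_x$ with $\operatorname{ord}_{\phi(x)}(\iota(f))=e_x\operatorname{ord}_x(f)$ for all $f\in\mathcal O_{E_X}^{\times}$. $\iota$ is value-preserving relative to $\phi$ if for each $x\in X^{\mathrm{cl}}-E_X$ there is an embedding of multiplicative groups $\iota_x:k(x)^{\times}\hookrightarrow k(\phi(x))^{\times}$ such that for every $f\in\mathcal O_{E_X}^{\times}$ with $\operatorname{ord}_x(f)=0$ one has $\operatorname{ord}_{\phi(x)}(\iota(f))=0$ and $\iota_x(f(x))=\iota(f)(\phi(x))$. *)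

(* Defs.v *)
(* A separated integral scheme X of finite type over k is presented in
   Chevalley's language (EGA I, 8): it is recorded by its function field K and
   by its points x, each with its local ring O_{X,x}, a local subring of K.
   The Zariski topology is determined by these rings: y lies in the
   closure of x exactly when O_{X,y} is contained in O_{X,x}.  A smooth connected scheme is integral,
   so proper, smooth, geometrically connected curves are covered.  *)

From HB Require Import structures.
From mathcomp Require Import all_boot all_order all_algebra ring_quotient.
From mathcomp Require Import boolp classical_sets functions cardinality.

Set Implicit Arguments.
Unset Strict Implicit.
Unset Printing Implicit Defensive.

Import GRing.Theory.
Local Open Scope ring_scope.
Local Open Scope classical_set_scope.
Local Open Scope quotient_scope.

Section CommutativeAlgebra.
Implicit Types R T S : comPzRingType.

Definition is_unit R (a : R) : Prop := exists b, a * b = 1.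

Definition is_ideal R (I : set R) : Prop :=
  [/\ I 0, (forall a b, I a -> I b -> I (a + b)) & forall a b, I b -> I (a * b)].

Definition is_prime R (P : set R) : Prop :=
  [/\ is_ideal P, ~ P 1 & forall a b, P (a * b) -> P a \/ P b].

Definition ideal_gen R (s : seq R) : set R :=
  [set a | forall I : set R, is_ideal I -> (forall b, b \in s -> I b) -> I a].

Definition is_noetherian R : Prop :=
  forall I : set R, is_ideal I -> exists s : seq R, I = ideal_gen s.

Definition is_local R : Prop :=
  (1 : R) <> 0 /\
  forall a b : R, ~ is_unit a -> ~ is_unit b -> ~ is_unit (a + b).

Definition prime_chain R (d : nat) (P : nat -> set R) : Prop :=
  (forall i, (i <= d)%N -> is_prime (P i)) /\
  (forall i, (i < d)%N -> P i `<` P i.+1).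

Definition has_krull_dim R (d : nat) : Prop :=
  (exists P : nat -> set R, prime_chain d P) /\
  ~ (exists P : nat -> set R, prime_chain d.+1 P).

Definition is_regular_local R : Prop :=
  [/\ is_local R, is_noetherian R &
      exists s : seq R, has_krull_dim R (size s) /\
                        ideal_gen s = [set a | ~ is_unit a]].

(* [l] exhibits [S] as the localization of [R] at the prime [P]. *)
Definition is_localization R S (P : set R) (l : {rmorphism R -> S}) : Prop :=
  [/\ (forall s, ~ P s -> is_unit (l s)),
      (forall b, exists a s, ~ P s /\ b * l s = l a) &
      forall a, l a = 0 -> exists s, ~ P s /\ s * a = 0].

Definition is_regular R : Prop :=
  forall P : set R, is_prime P ->
  forall (S : comPzRingType) (l : {rmorphism R -> S}),
    is_localization P l -> is_regular_local S.

(* Spec R is connected. *)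
Definition connected_spec R : Prop :=
  (1 : R) <> 0 /\ forall e : R, e * e = e -> e = 0 \/ e = 1.

(* [T] is the tensor product of [A] and [B] over [k], i.e. the pushout of the
   ring homomorphisms [a] and [b]. *)
Definition is_tensor (k : Type) (A B T : comPzRingType) (a : k -> A) (b : k -> B)
    (i : {rmorphism A -> T}) (j : {rmorphism B -> T}) : Prop :=
  (forall c, i (a c) = j (b c)) /\
  forall (S : comPzRingType) (f : {rmorphism A -> S}) (g : {rmorphism B -> S}),
    (forall c, f (a c) = g (b c)) ->
    exists h : {rmorphism T -> S},
      (h \o i =1 f /\ h \o j =1 g) /\
      forall h' : {rmorphism T -> S}, h' \o i =1 f -> h' \o j =1 g -> h' =1 h.

End CommutativeAlgebra.

Record subring (K : fieldType) := Subring {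
  subring_pred :> {pred K};
  subringP : subring_closed subring_pred }.

HB.instance Definition _ (K : fieldType) (A : subring K) :=
  GRing.isSubringClosed.Build K (subring_pred A) (subringP A).

Record subring_type (K : fieldType) (A : subring K) := SubringElt {
  subring_val : K;
  subring_valP : subring_val \in subring_pred A }.

Section SubringType.
Variables (K : fieldType) (A : subring K).
HB.instance Definition _ := [isSub for @subring_val K A].
HB.instance Definition _ := [Choice of subring_type A by <:].
HB.instance Definition _ := [SubChoice_isSubComNzRing of subring_type A by <:].
End SubringType.

Definition nonunit (K : fieldType) (A : subring K) : {pred K} :=
  [pred a | (a \in subring_pred A) && ((a == 0) || (a^-1 \notin subring_pred A))].

Record local_subring (K : fieldType) := LocalSubring {
  local_subring_ring :> subring K;
  local_subringP : {in nonunit local_subring_ring &, forall a b,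
                      a + b \in nonunit local_subring_ring} }.

Section ResidueField.
Variables (K : fieldType) (A : local_subring K).

Definition max_ideal : {pred subring_type A} :=
  [pred a | subring_val a \in nonunit A].

Lemma nonunitMl (a b : K) :
  a \in subring_pred A -> b \in nonunit A -> a * b \in nonunit A.
Proof.
move=> aA; rewrite !inE => /andP[bA hb].
rewrite (rpredM aA bA) /=; case: (eqVneq a 0) => [->|a0]; first by rewrite mul0r eqxx.
case/orP: hb => [/eqP->|hb]; first by rewrite mulr0 eqxx.
apply/orP; right; apply: contra hb => hab.
have -> : b^-1 = a * (a * b)^-1 by rewrite invfM mulrA mulfV // mul1r.
exact: rpredM.
Qed.

Lemma max_ideal_closed : idealr_closed max_ideal.
Proof.
split; first by rewrite !inE /= rpred0 eqxx.
  by rewrite !inE /= rpred1 oner_eq0 invr1 rpred1.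
move=> a u v uI vI; rewrite unfold_in /=.
by apply: local_subringP => //; apply: nonunitMl => //; exact: subring_valP.
Qed.

HB.instance Definition _ :=
  isIdealr.Build (subring_type A) max_ideal max_ideal_closed.

Definition residue_field : Type := {ideal_quot max_ideal}.

HB.instance Definition _ := GRing.ComNzRing.on residue_field.

Definition residue_class (a : subring_type A) : residue_field :=
  \pi_({ideal_quot max_ideal}) a.

Definition residue_inv (a : residue_field) : residue_field :=
  if a == 0 then 0 else
  residue_class (insubd 0 (subring_val (repr (a : {ideal_quot max_ideal})))^-1).

Lemma residue_mulVf (a : residue_field) : a != 0 -> residue_inv a * a = 1.
Proof.
rewrite /residue_inv => a0; rewrite (negPf a0).
set r := repr _; have ar : a = residue_class r by rewrite /residue_class reprK.
have rN : r \notin max_ideal.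
  apply: contra a0 => rI; rewrite ar /residue_class.
  by rewrite -[0]/(0 : {ideal_quot max_ideal}) piE Quotient.equivE subr0.
have rA : subring_val r \in subring_pred A := subring_valP r.
move: rN; rewrite !inE rA /= negb_or negbK => /andP[r0 rV].
rewrite [X in _ * X]ar /residue_class -rmorphM /= -[RHS](rmorph1 (\pi_{ideal_quot max_ideal})).
congr (\pi_({ideal_quot max_ideal}) _); apply: val_inj.
by rewrite /= insubdK // mulVf.
Qed.

Lemma residue_inv0 : residue_inv 0 = 0.
Proof. by rewrite /residue_inv eqxx. Qed.

HB.instance Definition _ :=
  GRing.ComNzRing_isField.Build residue_field residue_mulVf residue_inv0.

End ResidueField.

Section Places.
Variable K : fieldType.

Definition is_valuation_ring (V : local_subring K) : Prop :=
  forall z : K, z \in subring_pred V \/ z^-1 \in subring_pred V.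

Definition dominates (V A : local_subring K) : Prop :=
  {subset subring_pred A <= subring_pred V} /\ {subset nonunit A <= nonunit V}.

(* [n] is the value at [f] of the normalized discrete valuation of [A]. *)
Definition is_ord (A : local_subring K) (f : K) (n : int) : Prop :=
  exists p u : K,
    [/\ p != 0,
        (forall a, a \in nonunit A <-> exists2 b, b \in subring_pred A & a = p * b),
        u \in subring_pred A /\ u \notin nonunit A &
        f = u * p ^ n].

End Places.

Section Charts.
Variables (k K : fieldType) (c : k -> K).

(* The k-subalgebra of [K] generated by [g]. *)
Definition alg_gen (g : seq K) : set K :=
  [set a | forall A : subring K, (forall t, c t \in subring_pred A) ->
             {subset g <= subring_pred A} -> a \in subring_pred A].

Definition alg_prime (g : seq K) (P : set K) : Prop :=
  [/\ P `<=` alg_gen g, P 0 /\ ~ P 1,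
      (forall a b, P a -> P b -> P (a + b)),
      (forall a b, alg_gen g a -> P b -> P (a * b)) &
      forall a b, alg_gen g a -> alg_gen g b -> P (a * b) -> P a \/ P b].

Definition alg_localization (g : seq K) (P : set K) : set K :=
  [set z | exists a b, [/\ alg_gen g a, alg_gen g b, ~ P b & z = a / b]].

End Charts.

(* [variety_charts]: X is covered by finitely many affine charts Spec k[g],
   each [k[g]] having fraction field K.  [variety_separated]: a valuation of
   K/k has at most one centre on X. *)
Record variety (k : fieldType) := Variety {
  function_field : fieldType;
  scalar : {rmorphism k -> function_field};
  pt : Type;
  stalk : pt -> local_subring function_field;
  variety_charts : exists charts : seq (seq function_field),
    [/\ (forall g, g \in charts -> forall z, exists a b,
           [/\ alg_gen scalar g a, alg_gen scalar g b, b != 0 & z = a / b]),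
        (forall x, exists g P, [/\ g \in charts, alg_prime scalar g P &
           [set z | z \in subring_pred (stalk x)] = alg_localization scalar g P]) &
        (forall g P, g \in charts -> alg_prime scalar g P -> exists x,
           [set z | z \in subring_pred (stalk x)] = alg_localization scalar g P)];
  variety_separated : forall V : local_subring function_field,
    is_valuation_ring V -> (forall t, scalar t \in subring_pred V) ->
    forall x y, dominates V (stalk x) -> dominates V (stalk y) -> x = y }.

Arguments scalar {k} v.
Arguments stalk {k v} x.

Section Geometry.
Variables (k : fieldType) (X : variety k).
Local Notation K := (function_field X).
Implicit Types (x y z : pt X) (f : K).

(* Valuative criterion: every valuation of K/k has a centre on X. *)
Definition is_proper : Prop :=
  forall V : local_subring K,
    is_valuation_ring V -> (forall t, scalar X t \in subring_pred V) ->
    exists x, dominates V (stalk x).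

(* [y] lies in the closure of [x]. *)
Definition specializes x y : Prop :=
  {subset subring_pred (stalk y) <= subring_pred (stalk x)}.

Definition closed_points : set (pt X) :=
  [set x | forall y, specializes x y -> y = x].

(* X has Krull dimension 1; irreducible closed subsets are the closures of
   points. *)
Definition dimension_one : Prop :=
  (exists x y, specializes x y /\ y <> x) /\
  ~ (exists x y z, [/\ specializes x y, y <> x, specializes y z & z <> y]).

Lemma global_sections_closed :
  subring_closed [pred a : K | `[< forall x, a \in subring_pred (stalk x) >]].
Proof.
split=> [|a b ha hb|a b ha hb]; rewrite unfold_in /=; apply/asboolP => x.
- exact: rpred1.
- by apply: rpredB; [exact: (asboolW ha)|exact: (asboolW hb)].
- by apply: rpredM; [exact: (asboolW ha)|exact: (asboolW hb)].
Qed.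

Definition global_sections : subring K := Subring global_sections_closed.

Definition scalar_in (A : subring K) (t : k) : subring_type A :=
  insubd 0 (scalar X t).

(* X is geometrically regular over k: the local rings of the base change of X
   to k' are the localizations of the rings O_{X,x} (x) k'. *)
Definition is_smooth : Prop :=
  forall x (k' : fieldType) (j : {rmorphism k -> k'}) (T : comPzRingType)
    (i1 : {rmorphism subring_type (stalk x) -> T}) (i2 : {rmorphism k' -> T}),
    is_tensor (scalar_in (stalk x)) j i1 i2 -> is_regular T.

(* Every base change of X to a field k' is connected, i.e. its ring of global
   functions, which is O(X) (x) k' by flat base change, has no idempotents but
   0 and 1. *)
Definition geometrically_connected : Prop :=
  forall (k' : fieldType) (j : {rmorphism k -> k'}) (T : comPzRingType)
    (i1 : {rmorphism subring_type global_sections -> T})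
    (i2 : {rmorphism k' -> T}),
    is_tensor (scalar_in global_sections) j i1 i2 -> connected_spec T.

(* Junk value 0 when [f] is 0 or O_{X,x} is not a discrete valuation ring. *)
Definition ord x f : int := xget 0 [set n | is_ord (stalk x) f n].

(* f(x), with junk value 0 when [f] is not regular at [x]. *)
Definition value x f : residue_field (stalk x) :=
  residue_class (insubd 0 f).

(* X(k), as the set of points whose residue field is k. *)
Definition rational_points : set (pt X) :=
  [set x | forall a : residue_field (stalk x), exists t, a = value x (scalar X t)].

Definition semilocal_units (E : set (pt X)) : set K :=
  [set f | f != 0 /\ forall x, E x -> ord x f = 0].

End Geometry.

Arguments closed_points {k} X.
Arguments rational_points {k} X.

Section Preservation.
Variables (kX kY : fieldType) (X : variety kX) (Y : variety kY).
Variables (EX : set (pt X)) (phi : pt X -> pt Y).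
Variable iota : function_field X -> function_field Y.

Definition order_preserving : Prop :=
  forall x, (closed_points X `\` EX) x ->
    exists e : nat, (0 < e)%N /\
      forall f, semilocal_units EX f -> ord (phi x) (iota f) = e%:Z * ord x f.

Definition value_preserving : Prop :=
  forall x, (closed_points X `\` EX) x ->
    exists iota_x : residue_field (stalk x) -> residue_field (stalk (phi x)),
      [/\ (forall a, a != 0 -> iota_x a != 0),
          (forall a b, a != 0 -> b != 0 -> iota_x (a * b) = iota_x a * iota_x b),
          (forall a b, a != 0 -> b != 0 -> iota_x a = iota_x b -> a = b) &
          forall f, semilocal_units EX f -> ord x f = 0 ->
            ord (phi x) (iota f) = 0 /\
            iota_x (value x f) = value (phi x) (iota f)].

End Preservation.

(* Main.v *)
(** A proper smooth curve is seen through its closed points, i.e. through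
    discrete valuation rings [O_y] with maximal ideals [m_y].  Properness gives
    the centre principle: if [A] is a subring of the function field containing
    the constants, [p] is in [A] and [p^-1] is not, then some [O_y] contains [A]
    and has [p] in [m_y].  Two functions are then algebraically dependent over
    the field of constants, since otherwise some [O_y] would have rank two; hence
    a nonzero function vanishes at few points.

    Restricted to [k_X], [iota] is a multiplicative map [psi] into the constants
    [L] of [Y].  The main step is [iota (f - a) = iota f - psi a].  Write
    [F = iota f] and [w = iota (f - a) / (F - psi a)].  Since [phi] is a
    bijection and [iota] preserves values injectively, [w] is constant on the
    fibre of [F] over [psi b] for almost all [b] in [k_X].  Specializing a minimal
    relation [M (F, w) = 0] at [psi b] gives a multiple of a power
    [(U - d) ^+ n], so [w ^+ n] is a rational function of [F].  It has neither zero
    nor pole outside the fibre over [psi a], and it is 1 at the poles of [F],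
    hence [w ^+ n = 1], and [w] is a constant equal to 1 at the poles of [F].

    It follows that [psi] is a field embedding.  The graph of the extension of
    [iota] is the set of pairs [(z, w)] with [w (phi x) = psi (z x)] for almost all
    rational [x]; it is stable under field operations, functional because a nonzero
    function on [Y] has few zeros, and total because every [z] has the form
    [(u + d)^-1 + c] with [u] a unit and [c], [d] in [k_X]. *)

Require Import Defs.
From HB Require Import structures.
From mathcomp Require Import all_boot all_order all_algebra.
From mathcomp Require Import boolp classical_sets functions cardinality.
From mathcomp Require Import ring.

Set Implicit Arguments.
Unset Strict Implicit.
Unset Printing Implicit Defensive.

Import Order.TTheory GRing.Theory Num.Theory.
Local Open Scope ring_scope.
Local Open Scope classical_set_scope.

(** * Local subrings and valuation rings of a field *)

Section LocalSubring.
Variables (K : fieldType) (A : local_subring K).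
Implicit Types a b c d z : K.

Lemma nonunit_sub a : a \in nonunit A -> a \in subring_pred A.
Proof. by rewrite !inE => /andP[]. Qed.

Lemma nonunit0 : 0 \in nonunit A.
Proof. by rewrite !inE rpred0 eqxx. Qed.

Lemma nonunit1 : 1 \notin nonunit A.
Proof. by rewrite !inE rpred1 oner_eq0 invr1 rpred1. Qed.

Lemma nonunitP a :
  a != 0 -> a \in nonunit A <-> a \in subring_pred A /\ a^-1 \notin subring_pred A.
Proof. by move=> /negPf a0; rewrite !inE a0 /=; split=> [/andP|[-> ->]]. Qed.

Lemma nonunitV a : a \in subring_pred A -> a \notin nonunit A -> a^-1 \in subring_pred A.
Proof. by rewrite !inE => -> /=; rewrite negb_or negbK => /andP[]. Qed.

Lemma nonunitD a b : a \in nonunit A -> b \in nonunit A -> a + b \in nonunit A.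
Proof. by move=> ha hb; exact: local_subringP. Qed.

Lemma nonunitMr a b : a \in nonunit A -> b \in subring_pred A -> a * b \in nonunit A.
Proof. by move=> ha hb; rewrite mulrC nonunitMl. Qed.

Lemma nonunitN a : a \in nonunit A -> - a \in nonunit A.
Proof. by move=> ha; rewrite -mulN1r nonunitMl // rpredN rpred1. Qed.

Lemma nonunitB a b : a \in nonunit A -> b \in nonunit A -> a - b \in nonunit A.
Proof. by move=> ha hb; rewrite nonunitD ?nonunitN. Qed.

Lemma nonunit_mul a b : a \in subring_pred A -> b \in subring_pred A ->
  a * b \in nonunit A -> a \in nonunit A \/ b \in nonunit A.
Proof.
move=> aA bA ab; have [|an] := boolP (a \in nonunit A); first by left.
right; have a0 : a != 0 by apply: contraNneq an => ->; exact: nonunit0.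
by rewrite -[b](mulKf a0) nonunitMl // nonunitV.
Qed.

Lemma nonunit_congr a b : a - b \in nonunit A -> a \in nonunit A <-> b \in nonunit A.
Proof.
move=> ab; split=> h; last by rewrite -[a](subrK b) nonunitD.
by rewrite -[b](subKr a) nonunitB.
Qed.

Lemma congr_trans b a c : a - b \in nonunit A -> b - c \in nonunit A -> a - c \in nonunit A.
Proof. by move=> ab bc; rewrite -[a](subrK b) -addrA nonunitD. Qed.

Lemma congr_sym a b : a - b \in nonunit A -> b - a \in nonunit A.
Proof. by rewrite -opprB => /nonunitN; rewrite opprK. Qed.

Lemma congr_sub a b : b \in subring_pred A -> a - b \in nonunit A -> a \in subring_pred A.
Proof. by move=> bA /nonunit_sub ab; rewrite -[a](subrK b) rpredD. Qed.

Lemma congrD a b c d : a - b \in nonunit A -> c - d \in nonunit A ->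
  a + c - (b + d) \in nonunit A.
Proof. by move=> ab cd; rewrite opprD addrACA nonunitD. Qed.

Lemma congrN a b : a - b \in nonunit A -> - a - - b \in nonunit A.
Proof. by rewrite -opprD => /nonunitN. Qed.

Lemma congrM a b c d : b \in subring_pred A -> d \in subring_pred A ->
  a - b \in nonunit A -> c - d \in nonunit A -> a * c - b * d \in nonunit A.
Proof.
move=> bA dA ab cd; have cA := congr_sub dA cd.
have -> : a * c - b * d = (a - b) * c + b * (c - d) by ring.
by apply: nonunitD; [exact: nonunitMr|exact: nonunitMl].
Qed.

Lemma congrX a b n : b \in subring_pred A -> a - b \in nonunit A ->
  a ^+ n - b ^+ n \in nonunit A.
Proof.
move=> bA ab; elim: n => [|n IH]; first by rewrite subrr nonunit0.
by rewrite !exprS congrM ?rpredX.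
Qed.

Lemma congrV a b : b \in subring_pred A -> b \notin nonunit A ->
  a - b \in nonunit A -> a^-1 - b^-1 \in nonunit A.
Proof.
move=> bA bn ab; have aA := congr_sub bA ab.
have an : a \notin nonunit A by apply: contra bn => /(nonunit_congr ab).
have nz c : c \notin nonunit A -> c != 0 by apply: contraNneq => ->; exact: nonunit0.
have -> : a^-1 - b^-1 = (a^-1 * b^-1) * (b - a) by field; rewrite !nz.
by apply: nonunitMl; [apply: rpredM; exact: nonunitV|exact: congr_sym].
Qed.

Hypothesis Aval : is_valuation_ring A.

Lemma valuation_nonunitV a : a \notin subring_pred A -> a^-1 \in nonunit A.
Proof.
move=> an; have a0 : a != 0 by apply: contraNneq an => ->; exact: rpred0.
by apply/nonunitP; rewrite ?invr_eq0 // invrK; split=> //; case: (Aval a) an => // ->.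
Qed.

End LocalSubring.

(** * Subrings maximal among those that omit [p^-1] *)

Section MaximalSubring.
Variables (K : fieldType) (B : subring K) (p : K).
Hypothesis pB : p \in subring_pred B.
Hypothesis pVB : p^-1 \notin subring_pred B.
Hypothesis Bmax : forall C : subring K, {subset subring_pred B <= subring_pred C} ->
  p^-1 \notin subring_pred C -> {subset subring_pred C <= subring_pred B}.

Let p0 : p != 0.
Proof. by apply: contraNneq pVB => ->; rewrite invr0 rpred0. Qed.

Definition adjoin_pred (z : K) : {pred K} :=
  [pred a | `[< exists2 q : {poly K}, q \is a polyOver (subring_pred B) & a = q.[z] >]].

Lemma adjoin_closed z : subring_closed (adjoin_pred z).
Proof.
split=> [|a b /asboolP[q qB ->] /asboolP[r rB ->]|a b /asboolP[q qB ->] /asboolP[r rB ->]];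
  apply/asboolP.
- by exists 1; rewrite ?rpred1 // hornerC.
- by exists (q - r); rewrite ?rpredB // hornerD hornerN.
- by exists (q * r); rewrite ?rpredM // hornerM.
Qed.

Definition adjoin z : subring K := Subring (adjoin_closed z).

Lemma adjoin_inv z : z \notin subring_pred B ->
  exists2 q : {poly K}, q \is a polyOver (subring_pred B) & p^-1 = q.[z].
Proof.
move=> zB; apply: contrapT => h; move/negP: zB; apply.
apply: (Bmax (C := adjoin z)).
- by move=> a aB; apply/asboolP; exists a%:P; rewrite ?polyOverC // hornerC.
- by apply/negP => /asboolP.
- by apply/asboolP; exists 'X; rewrite ?polyOverX // hornerX.
Qed.

(** This puts [p] in the Jacobson radical of [B]. If [u = 1 - p b] were not invertible, maximality
    would give [p^-1 = q(u^-1)]; clearing denominators puts a power of [u] in [p B], while [u] is 1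
    modulo [p], so [p^-1] would lie in [B]. *)
Lemma one_minus_unit b : b \in subring_pred B -> (1 - p * b)^-1 \in subring_pred B.
Proof.
move=> bB; set u := 1 - p * b; have uB : u \in subring_pred B by rewrite rpredB ?rpred1 ?rpredM.
apply: contrapT => /negP/adjoin_inv[q qB pq].
have u0 : u != 0.
  apply: contraNneq pVB => /eqP; rewrite subr_eq0 => /eqP pb.
  by rewrite -[p^-1]mulr1 pb mulKf.
have [c cB Ec] : exists2 c, c \in subring_pred B & u ^+ size q = p * c.
  exists (\sum_(i < size q) q`_i * u ^+ (size q - i)).
    by apply: rpred_sum => i _; rewrite rpredM ?rpredX // (polyOverP qB).
  rewrite -[LHS](mulVKf p0); congr (_ * _); rewrite pq horner_coef mulr_suml.
  apply: eq_bigr => i _; rewrite -mulrA; congr (_ * _).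
  have -> : u ^+ size q = u ^+ i * u ^+ (size q - i) by rewrite -exprD subnKC // ltnW.
  by rewrite exprVn mulKf ?expf_neq0.
have [d dB Ed] : exists2 d, d \in subring_pred B & u ^+ size q = 1 - p * d.
  elim: (size q) => [|n [d dB Ed]]; first by exists 0; rewrite ?rpred0 // mulr0 subr0.
  exists (b + d - p * b * d); first by rewrite rpredB ?rpredD ?rpredM.
  by rewrite exprS Ed /u; ring.
move/negP: pVB; apply; suff -> : p^-1 = c + d by rewrite rpredD.
by apply: (mulfI p0); rewrite mulfV // mulrDr -Ec Ed subrK.
Qed.

(** A certificate that [p^-1] lies in [B[z]]; its length [n] is recorded for a descent. *)
Definition rad_rep z n := exists2 q : {poly K},
  q \is a polyOver (subring_pred B) /\ (size q <= n)%N & 1 = p * q.[z].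

(** Multiplied by [z ^+ n], the relation for [z^-1] expresses [z ^+ n] through lower powers of [z],
    because [1 - p d_0] is a unit of [B]. Substituting this in the relation for [z] removes its top
    term. *)
Lemma rad_rep_shorten z n : z != 0 ->
  rad_rep z n.+1 -> rad_rep z^-1 n.+1 -> rad_rep z n.
Proof.
move=> z0 [c [/polyOverP cB sc] Ec] [d [/polyOverP dB sd] Ed].
have u0 : 1 - p * d`_0 != 0.
  apply: contraNneq pVB => /eqP; rewrite subr_eq0 => /eqP pd.
  by rewrite -[p^-1]mulr1 pd mulKf.
pose v := (1 - p * d`_0)^-1.
have vB : v \in subring_pred B by exact: one_minus_unit.
have Ez : z ^+ n = p * v * \sum_(i < n) d`_(n - i) * z ^+ i.
  have : z ^+ n = p * \sum_(i < n.+1) d`_(n - i) * z ^+ i.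
    rewrite -[LHS]mulr1 Ed (horner_coef_wide _ sd) mulrCA mulr_sumr; congr (_ * _).
    rewrite (reindex_inj rev_ord_inj) /=; apply: eq_bigr => i _.
    rewrite subSS mulrCA exprVn; congr (_ * _).
    have lein : (i <= n)%N by rewrite -ltnS.
    have -> : z ^+ n = z ^+ i * z ^+ (n - i) by rewrite -exprD subnKC.
    by rewrite mulfK ?expf_neq0.
  rewrite big_ord_recr /= subnn mulrDr => Ez.
  set S := \sum_(i < n) _ in Ez *; apply: (mulfI u0).
  have -> : (1 - p * d`_0) * (p * v * S) = p * S by rewrite /v; field.
  by rewrite mulrBl mul1r {1}Ez; ring.
exists (\poly_(i < n) (c`_i + c`_n * p * v * d`_(n - i))).
  split; last exact: size_poly.
  by apply/polyOverP => i; rewrite coef_poly; case: ifP; rewrite ?rpred0 // rpredD // !rpredM.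
rewrite Ec (horner_coef_wide _ sc) horner_poly big_ord_recr /= {}Ez; congr (_ * _).
under [in RHS]eq_bigr do rewrite mulrDl.
rewrite big_split /=; congr (_ + _); rewrite mulrA mulr_sumr.
by apply: eq_bigr => i _; rewrite !mulrA.
Qed.

(* Relations of the same length for [z] and for [z^-1] shorten each other. *)
Lemma rad_rep_inv z n : z != 0 -> rad_rep z n -> ~ rad_rep z^-1 n.
Proof.
move=> z0; elim: n => [|n IH] hz hzV.
  case: hz => q [_]; rewrite leqn0 size_poly_eq0 => /eqP-> /eqP.
  by rewrite horner0 mulr0 oner_eq0.
apply: IH; first exact: rad_rep_shorten hzV.
by apply: rad_rep_shorten; rewrite ?invr_eq0 // invrK.
Qed.

Lemma maximal_valuation z : z \in subring_pred B \/ z^-1 \in subring_pred B.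
Proof.
apply: contrapT => /not_orP[/negP zB /negP zVB].
have z0 : z != 0 by apply: contraNneq zB => ->; exact: rpred0.
have [q qB Eq] := adjoin_inv zB; have [r rB Er] := adjoin_inv zVB.
apply: (@rad_rep_inv z (maxn (size q) (size r)) z0).
  by exists q; rewrite ?leq_maxl // -Eq mulfV.
by exists r; rewrite ?leq_maxr // -Er mulfV.
Qed.

End MaximalSubring.

(** * Existence of valuation overrings *)

Section ValuationOverring.
Variable K : fieldType.

Lemma valuation_local (B : subring K) :
  (forall z, z \in subring_pred B \/ z^-1 \in subring_pred B) ->
  {in nonunit B &, forall a b, a + b \in nonunit B}.
Proof.
move=> Bval a b; have [->|a0] := eqVneq a 0; first by rewrite add0r.
have [->|b0] := eqVneq b 0; first by rewrite addr0.
wlog abB : a b a0 b0 / a / b \in subring_pred B.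
  move=> W ha hb; case: (Bval (a / b)) => h; first exact: W.
  by rewrite addrC; apply: W => //; rewrite -invf_div.
rewrite !inE => /andP[aB _] /andP[bB]; rewrite (negPf b0) /= => bV.
rewrite rpredD //=; have [//|ab0] := eqVneq (a + b) 0; apply: contra bV => abV.
have -> : b^-1 = (a / b + 1) * (a + b)^-1 by field; rewrite ?b0 ?ab0.
by rewrite rpredM // rpredD ?rpred1.
Qed.

Lemma exists_maximal_subring (A : subring K) (q : K) : q \notin subring_pred A ->
  exists B : subring K, [/\ {subset subring_pred A <= subring_pred B},
    q \notin subring_pred B &
    forall C : subring K, {subset subring_pred B <= subring_pred C} ->
      q \notin subring_pred C -> {subset subring_pred C <= subring_pred B}].
Proof.
move=> qA.
pose S (B : set K) := [/\ subring_closed [pred a | `[< B a >]],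
  {subset subring_pred A <= [pred a | `[< B a >]]} & ~ B q].
have toS (B : subring K) : {subset subring_pred A <= subring_pred B} -> q \notin subring_pred B ->
    S [set a | a \in subring_pred B].
  move=> AB qB; split; last by apply/negP.
    split=> [|a b /asboolP ha /asboolP hb|a b /asboolP ha /asboolP hb]; apply/asboolP.
    - exact: (rpred1 (subring_pred B)).
    - exact: (@rpredB _ (subring_pred B)).
    - exact: (@rpredM _ (subring_pred B)).
  by move=> a aA; apply/asboolP/AB.
have [B []] : exists B : set K, (B = set0 \/ S B) /\
    forall C, B `<` C -> ~ (C = set0 \/ S C).
  apply: (@Zorn_bigcup K (fun B => B = set0 \/ S B)) => F FS Ftot.
  have [[B0 FB0 SB0]|hF] := pselect (exists2 B, F B & S B); last first.
    left; apply/seteqP; split=> // a [B FB Ba].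
    by case: (FS B FB) Ba => [->//|SB]; case: hF; exists B.
  right; have FS' B a : F B -> B a -> S B by move=> FB Ba; case: (FS B FB) Ba => [->|].
  have ub a b : (\bigcup_(X in F) X) a -> (\bigcup_(X in F) X) b ->
      exists B, [/\ F B, S B, B a & B b].
    move=> [B FB Ba] [C FC Cb].
    case: (Ftot _ _ FB FC) => [BC|CB]; [exists C|exists B]; split=> //.
    - exact: FS' FC Cb.
    - exact: BC.
    - exact: FS' FB Ba.
    - exact: CB.
  split; first split.
  - by apply/asboolP; exists B0 => //; case: SB0 => [[/asboolP]].
  - move=> a b /asboolP ha /asboolP hb; apply/asboolP.
    have [B [FB [[_ h _] _ _] Ba Bb]] := ub _ _ ha hb; exists B => //.
    by have /asboolP := h a b (asboolT Ba) (asboolT Bb).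
  - move=> a b /asboolP ha /asboolP hb; apply/asboolP.
    have [B [FB [[_ _ h] _ _] Ba Bb]] := ub _ _ ha hb; exists B => //.
    by have /asboolP := h a b (asboolT Ba) (asboolT Bb).
  - move=> a aA; apply/asboolP; exists B0 => //; case: SB0 => _ h _.
    by have /asboolP := h a aA.
  - by move=> [B FB Bq]; case: (FS' _ _ FB Bq).
move=> [->|[Bc AB Bq]] Bmax.
  case: (Bmax [set a | a \in subring_pred A]); last by right; apply: toS.
  rewrite properEneq; split=> //; apply/eqP => h.
  by have : [set a | a \in subring_pred A] 1 := rpred1 _; rewrite -h.
exists (Subring Bc); split; first exact: AB.
  by apply/negP => /asboolP.
move=> C BC qC a aC; apply: contrapT => aB.
case: (Bmax [set a | a \in subring_pred C]).
  split; first by move=> b Bb; apply: BC; apply/asboolP.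
  by move=> h; apply: aB; apply/asboolP; apply: h.
right; apply: toS => // b /AB; exact: BC.
Qed.

(** Supplies the valuation ring to which the valuative criterion of properness is applied: [p] lies
    in its maximal ideal whenever [p] is nonzero. *)
Lemma valuation_overring (A : subring K) (p : K) :
  p \in subring_pred A -> p^-1 \notin subring_pred A ->
  exists V : local_subring K, [/\ is_valuation_ring V,
    {subset subring_pred A <= subring_pred V} & p^-1 \notin subring_pred V].
Proof.
move=> pA pVA; have [B [AB pVB Bmax]] := exists_maximal_subring pVA.
have Bval := maximal_valuation (AB _ pA) pVB Bmax.
by exists (LocalSubring (valuation_local Bval)).
Qed.

End ValuationOverring.

(** * Places of a complete curve *)

Section Evaluation.
Variables (k K : fieldType) (j : {rmorphism k -> K}).

Definition ev (a : K) : {poly k} -> K := horner_eval a \o map_poly j.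
HB.instance Definition _ a := GRing.RMorphism.copy (ev a) (horner_eval a \o map_poly j).

(** Coefficients are polynomials in the first function, so that a relation can be specialized at a
    value of that function and remain a polynomial in the second. *)
Definition ev2 (a b : K) : {poly {poly k}} -> K := horner_eval b \o map_poly (ev a).
HB.instance Definition _ a b :=
  GRing.RMorphism.copy (ev2 a b) (horner_eval b \o map_poly (ev a)).

Lemma evC a c : ev a c%:P = j c.
Proof. by rewrite /ev /= map_polyC /horner_eval hornerC. Qed.

Lemma evX a : ev a 'X = a.
Proof. by rewrite /ev /= map_polyX /horner_eval hornerX. Qed.

Lemma ev2C a b q : ev2 a b q%:P = ev a q.
Proof. by rewrite /ev2 /= map_polyC /horner_eval hornerC. Qed.

Lemma ev2X a b : ev2 a b 'X = b.
Proof. by rewrite /ev2 /= map_polyX /horner_eval hornerX. Qed.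

Lemma ev0 a : ev a 0 = 0. Proof. exact: rmorph0. Qed.
Lemma ev1 a : ev a 1 = 1. Proof. exact: rmorph1. Qed.
Lemma evD a : {morph ev a : p q / p + q}. Proof. exact: rmorphD. Qed.
Lemma evN a : {morph ev a : p / - p}. Proof. exact: rmorphN. Qed.
Lemma evM a : {morph ev a : p q / p * q}. Proof. exact: rmorphM. Qed.
Lemma evXn a n : {morph ev a : p / p ^+ n}. Proof. exact: rmorphXn. Qed.
Definition evE := (ev0, ev1, evD, evN, evM, evXn, evX, evC).

Lemma ev20 a b : ev2 a b 0 = 0. Proof. exact: rmorph0. Qed.
Lemma ev21 a b : ev2 a b 1 = 1. Proof. exact: rmorph1. Qed.
Lemma ev2D a b : {morph ev2 a b : p q / p + q}. Proof. exact: rmorphD. Qed.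
Lemma ev2N a b : {morph ev2 a b : p / - p}. Proof. exact: rmorphN. Qed.
Lemma ev2M a b : {morph ev2 a b : p q / p * q}. Proof. exact: rmorphM. Qed.
Lemma ev2Xn a b n : {morph ev2 a b : p / p ^+ n}. Proof. exact: rmorphXn. Qed.
Definition ev2E := (ev20, ev21, ev2D, ev2N, ev2M, ev2Xn, ev2X, ev2C).

Lemma ev_const c q : ev (j c) q = j q.[c].
Proof. by rewrite /ev /= /horner_eval horner_map. Qed.

Lemma ev2_const c d R : ev2 (j c) (j d) R = j R.[d%:P].[c].
Proof. by rewrite /ev2 /= /horner_eval -(evC (j c) d) horner_map; exact: ev_const. Qed.

Lemma ev_sub (A : subring K) a q :
  (forall c, j c \in subring_pred A) -> a \in subring_pred A -> ev a q \in subring_pred A.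
Proof.
move=> jA aA; elim/poly_ind: q => [|q c IH]; first by rewrite ev0 rpred0.
by rewrite !evE rpredD ?rpredM.
Qed.

Section Congruence.
Variable O : local_subring K.
Hypothesis jO : forall c, j c \in subring_pred O.

Lemma scalar_nonunit c : j c \in nonunit O -> c = 0.
Proof.
move=> jc; apply/eqP; apply: contraT => c0; move/negP: (nonunit1 O); case.
by rewrite -(rmorph1 j) -(mulfV c0) rmorphM nonunitMr.
Qed.

Lemma scalar_congr c d : j c - j d \in nonunit O -> c = d.
Proof. by rewrite -rmorphB => /scalar_nonunit/eqP; rewrite subr_eq0 => /eqP. Qed.

Lemma scalar_unit c : c != 0 -> j c \notin nonunit O.
Proof. by apply: contraNN => /scalar_nonunit->. Qed.

Lemma ev_congr a b q : b \in subring_pred O -> a - b \in nonunit O ->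
  ev a q - ev b q \in nonunit O.
Proof.
move=> bO ab; elim/poly_ind: q => [|q c IH]; first by rewrite !ev0 subrr nonunit0.
rewrite !evE; apply: congrD; last by rewrite subrr nonunit0.
by apply: congrM => //; exact: ev_sub.
Qed.

Lemma ev2_sub a b R : a \in subring_pred O -> b \in subring_pred O ->
  ev2 a b R \in subring_pred O.
Proof.
move=> aO bO; elim/poly_ind: R => [|R c IH]; first by rewrite ev20 rpred0.
by rewrite !ev2E rpredD ?rpredM ?ev_sub.
Qed.

Lemma ev2_congr a b c d R : c \in subring_pred O -> d \in subring_pred O ->
  a - c \in nonunit O -> b - d \in nonunit O -> ev2 a b R - ev2 c d R \in nonunit O.
Proof.
move=> cO dO ac bd; elim/poly_ind: R => [|R e IH]; first by rewrite !ev20 subrr nonunit0.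
rewrite !ev2E; apply: congrD; last exact: ev_congr.
by apply: congrM => //; exact: ev2_sub.
Qed.

End Congruence.
End Evaluation.

(* The closed points of a complete regular curve with function field [K] over
   [k], seen as a family of valuation rings. *)
Record complete_places (k K : fieldType) (j : {rmorphism k -> K}) (P : Type)
    (O : P -> local_subring K) : Prop := CompletePlaces {
  places_scalar : forall y c, j c \in subring_pred (O y);
  places_valuation : forall y, is_valuation_ring (O y);
  places_rank_one : forall y p z, p \in nonunit (O y) -> p != 0 ->
    exists n, p ^+ n * z \in subring_pred (O y);
  places_centre : forall (A : subring K) (p : K),
    (forall c, j c \in subring_pred A) ->
    p \in subring_pred A -> p != 0 -> p^-1 \notin subring_pred A ->
    exists y, {subset subring_pred A <= subring_pred (O y)} /\ p \in nonunit (O y) }.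

(** * Consequences of the centre principle *)

Section Places.
Variables (k K : fieldType) (j : {rmorphism k -> K}) (P : Type).
Variables (O : P -> local_subring K) (CP : complete_places j O).
Implicit Types (F D w z : K) (y : P).

Let jO y c : j c \in subring_pred (O y) := places_scalar CP y c.

(* If [F] and [D] were algebraically independent, then a valuation ring
   containing every [F / D ^+ n], with [D] in its maximal ideal, would not have
   rank one. *)
Lemma algebraic_dependence F D : exists R : {poly {poly k}}, R != 0 /\ ev2 j D F R = 0.
Proof.
apply: contrapT => indep.
have {}indep R : ev2 j D F R = 0 -> R = 0.
  by move=> R0; apply/eqP; apply: contraT => nz; case: indep; exists R.
have D0 : D != 0.
  apply/eqP => D0; have := indep 'X%:P; rewrite ev2C evX => /(_ D0)/eqP.
  by rewrite polyC_eq0 polyX_eq0.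
have F0 : F != 0.
  by apply/eqP => F0; have := indep 'X; rewrite ev2X => /(_ F0)/eqP; rewrite polyX_eq0.
(* This is the ring [k[D] + F k[D, D^-1, F]]. It contains all [F / D ^+ n], but not [D^-1]. *)
pose S : {pred K} := [pred z | `[< exists n c R,
   D ^+ n * (z - ev j D c) = F * ev2 j D F R >]].
have Sc : subring_closed S.
  split=> [|a b /asboolP[n [c [R E]]] /asboolP[n' [c' [R' E']]]
    |a b /asboolP[n [c [R E]]] /asboolP[n' [c' [R' E']]]]; apply/asboolP.
  - by exists 0%N, 1, 0; rewrite ev20 ev1 subrr !mulr0.
  - exists (n + n')%N, (c - c'), ('X^n'%:P * R - 'X^n%:P * R').
    rewrite !ev2E !evE exprD.
    rewrite (_ : _ * _ = D ^+ n' * (D ^+ n * (a - ev j D c)) -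
       D ^+ n * (D ^+ n' * (b - ev j D c'))); last by ring.
    by rewrite E E'; ring.
  - exists (n + n')%N, (c * c'),
      (('X^n * c)%:P * R' + ('X^n' * c')%:P * R + 'X * R * R').
    rewrite !ev2E !evE exprD.
    set x := ev j D c; set x' := ev j D c'.
    rewrite (_ : _ * _ = D ^+ n * x * (D ^+ n' * (b - x')) +
       D ^+ n' * x' * (D ^+ n * (a - x)) + (D ^+ n * (a - x)) * (D ^+ n' * (b - x')));
      last by ring.
    by rewrite E E'; ring.
have SF n : F / D ^+ n \in Subring Sc.
  apply/asboolP; exists n, 0, 1; rewrite ev0 ev21 subr0 mulr1 mulrC.
  by rewrite divfK ?expf_neq0.
have SD : D \in Subring Sc.
  by apply/asboolP; exists 0%N, 'X, 0; rewrite evX ev20 subrr !mulr0.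
have [||//||y [Sy Dy]] := places_centre CP (A := Subring Sc) (p := D).
- by move=> c; apply/asboolP; exists 0%N, c%:P, 0; rewrite evC ev20 subrr !mulr0.
- exact: SD.
- apply/negP => /asboolP[n [c [R E]]].
  (* If [D^-1] were in [S], the terms free of [F] would give [X^n (1 - X c) = 0], hence [1 = X c],
     which is false at 0. *)
  have /indep/(congr1 (fun Q : {poly {poly k}} => Q`_0)) :
      ev2 j D F (('X^n * (1 - 'X * c))%:P - 'X * ('X%:P * R)) = 0.
    rewrite !ev2E !evE [F * _]mulrCA -E; field; exact: D0.
  rewrite coefB coefC coefXM /= subr0 coef0 => /eqP.
  rewrite mulf_eq0 expf_eq0 polyX_eq0 andbF /= subr_eq0 => /eqP.
  move/(congr1 (horner^~ 0)); rewrite hornerM hornerX hornerC mul0r => /eqP.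
  by rewrite oner_eq0.
have [n nF] := places_rank_one CP F^-1 Dy D0.
move/nonunitP: (Dy) => /(_ D0)[_ /negP[]].
have -> : D^-1 = F / D ^+ n.+1 * (D ^+ n * F^-1).
  by rewrite exprS; field; rewrite ?F0 ?D0 ?expf_neq0.
by rewrite rpredM // Sy.
Qed.

Lemma minimal_relation F D : exists R : {poly {poly k}},
  [/\ R != 0, ev2 j D F R = 0 &
      forall R', ev2 j D F R' = 0 -> (size R' < size R)%N -> R' = 0].
Proof.
pose Q n := `[< exists R : {poly {poly k}}, [/\ R != 0, ev2 j D F R = 0 & size R = n] >].
have exQ : exists n, Q n.
  by have [R [R0 RE]] := algebraic_dependence F D; exists (size R); apply/asboolP; exists R.
case: (ex_minnP exQ) => n /asboolP[R [R0 RE Rn]] nmin; exists R; split=> // R' R'E lt_R.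
apply/eqP; apply: contraLR lt_R => R'0; rewrite -leqNgt Rn; apply: nmin.
by apply/asboolP; exists R'.
Qed.

(** A relation between [F] and [D] of minimal degree in [D] is not divisible by [D], so setting
    [D = 0] in it leaves a nonzero polynomial, which kills the values of [F] at the zeros of [D]. *)
Lemma values_at_zeros F D : D != 0 -> exists q : {poly k}, q != 0 /\
  forall y c, D \in nonunit (O y) -> F - j c \in nonunit (O y) -> q.[c] = 0.
Proof.
move=> D0; have [R [R0 RE Rmin]] := minimal_relation D F.
exists R.[0]; split.
  apply: contraNneq R0 => /rootP/factor_theorem[R' ER].
  suff: R' = 0 by rewrite ER => ->; rewrite mul0r.
  have R'E : ev2 j F D R' = 0.
    move/eqP: RE; rewrite ER !ev2E ?ev0 subr0.
    by rewrite mulf_eq0 (negPf D0) orbF => /eqP.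
  apply: contrapT => /eqP R'0; move/eqP: (R'0); apply; apply: Rmin => //.
  by rewrite ER polyC0 subr0 size_mulX.
move=> y c Dy Fc; apply: (scalar_nonunit (jO y)).
have : ev2 j F D R - ev2 j (j c) (j 0) R \in nonunit (O y).
  by apply: ev2_congr => //; rewrite rmorph0 subr0.
by rewrite RE sub0r ev2_const => /nonunitN; rewrite opprK.
Qed.

Definition transcendental F := forall q, ev j F q = 0 -> q = 0.

(** At a pole of [F] the leading term of a polynomial in [F] dominates the others. *)
Lemma ev_at_pole F y q : F \notin subring_pred (O y) -> q != 0 ->
  ev j F q * F^-1 ^+ (size q).-1 - j (lead_coef q) \in nonunit (O y).
Proof.
move=> Fy; have tm := valuation_nonunitV (places_valuation CP y) Fy.
have F0 : F != 0 by apply: contraNneq Fy => ->; exact: rpred0.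
elim/poly_ind: q => [|q c IH]; first by rewrite eqxx.
have [->|q0] := eqVneq q 0 => [|_].
  rewrite mul0r add0r polyC_eq0 => c0; rewrite evC size_polyC c0 lead_coefC mulr1.
  by rewrite subrr nonunit0.
rewrite size_MXaddC (negPf q0) /= lead_coefDl; last first.
  by rewrite size_mulX // ltnS (leq_trans (size_polyC_leq1 c)) // lt0n size_poly_eq0.
rewrite lead_coefMX !evE.
have sq : size q = (size q).-1.+1 by rewrite prednK // lt0n size_poly_eq0.
rewrite {1}sq (_ : _ - _ = (ev j F q * F^-1 ^+ (size q).-1 - j (lead_coef q)) +
   F^-1 * (j c * F^-1 ^+ (size q).-1)); last by rewrite exprS; field.
apply: nonunitD; first exact: IH.
by apply: nonunitMr => //; apply: rpredM; [exact: jO|apply: rpredX; exact: nonunit_sub].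
Qed.

Lemma algebraic_sub F q y : ev j F q = 0 -> q != 0 -> F \in subring_pred (O y).
Proof.
move=> q0 qn0; apply: contraT => Fy; have := ev_at_pole Fy qn0.
rewrite q0 mul0r sub0r => /nonunitN; rewrite opprK => /(scalar_nonunit (jO y))/eqP.
by rewrite lead_coef_eq0 (negPf qn0).
Qed.

(** This makes the ring of global functions a field. If [F] lies in [k[F^-1]], then [F^-1] is
    algebraic over [k], hence regular everywhere. Otherwise the centre principle yields a zero of
    [F^-1], which is a pole of [F]. *)
Lemma global_inv F : (forall y, F \in subring_pred (O y)) ->
  forall y, F^-1 \in subring_pred (O y).
Proof.
move=> Fy y; have [->|F0] := eqVneq F 0; first by rewrite invr0 rpred0.
pose S : {pred K} := [pred z | `[< exists r, z = ev j F^-1 r >]].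
have Sc : subring_closed S.
  split=> [|a b /asboolP[r ->] /asboolP[s ->]|a b /asboolP[r ->] /asboolP[s ->]]; apply/asboolP.
  - by exists 1; rewrite ev1.
  - by exists (r - s); rewrite !evE.
  - by exists (r * s); rewrite evM.
have [/asboolP[r Er]|FS] := boolP (S F).
  apply: (@algebraic_sub _ ('X * r - 1)); first by rewrite !evE -Er mulVf // subrr.
  apply: contraTneq isT => /(congr1 (horner^~ 0));
  rewrite hornerD hornerN hornerM hornerX mul0r sub0r !hornerC => /eqP.
  by rewrite oppr_eq0 oner_eq0.
have [||||z [_]] := places_centre CP (A := Subring Sc) (p := F^-1).
- by move=> c; apply/asboolP; exists c%:P; rewrite evC.
- by apply/asboolP; exists 'X; rewrite evX.
- by rewrite invr_eq0.
- by rewrite invrK.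
by move/nonunitP; rewrite invr_eq0 invrK Fy => /(_ F0)[].
Qed.

Hypothesis constants : forall z, (forall y, z \in subring_pred (O y)) -> exists c, z = j c.

Lemma nonconstant_transcendental F : (forall c, F != j c) -> transcendental F.
Proof.
move=> Fc q q0; apply/eqP; apply: contraT => qn0.
have /constants[c Ec] : forall y, F \in subring_pred (O y) by move=> y; exact: algebraic_sub qn0.
by move: (Fc c); rewrite Ec eqxx.
Qed.

(** Here [k[F]] is a polynomial ring, in which a nonconstant polynomial is not invertible, and the
    centre principle applies to it. *)
Lemma transcendental_fibre F (q : {poly k}) : transcendental F -> (1 < size q)%N ->
  exists y, F \in subring_pred (O y) /\ ev j F q \in nonunit (O y).
Proof.
move=> Ft q1.
pose S : {pred K} := [pred z | `[< exists r, z = ev j F r >]].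
have Sc : subring_closed S.
  split=> [|a b /asboolP[r ->] /asboolP[s ->]|a b /asboolP[r ->] /asboolP[s ->]]; apply/asboolP.
  - by exists 1; rewrite ev1.
  - by exists (r - s); rewrite !evE.
  - by exists (r * s); rewrite evM.
have qn0 : ev j F q != 0.
  by apply: contraTneq q1 => /Ft->; rewrite size_poly0.
have [||//||y [Sy qy]] := places_centre CP (A := Subring Sc) (p := ev j F q).
- by move=> c; apply/asboolP; exists c%:P; rewrite evC.
- by apply/asboolP; exists q.
- apply/negP => /asboolP[r Er]; suff qr : q * r = 1.
    have /eqP : size (q * r) = 1%N by rewrite qr size_poly1.
    by rewrite size_mul_eq1 => /andP[/eqP s1]; rewrite s1 in q1.
  apply/eqP; rewrite -subr_eq0; apply/eqP/Ft.
  by rewrite !evE -Er mulfV // subrr.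
exists y; split=> //; apply: Sy; apply/asboolP; exists 'X; by rewrite evX.
Qed.

End Places.

(** * Functions that are constant on almost all fibres of a transcendental function *)

Section FibreConstant.
Variables (k K : fieldType) (j : {rmorphism k -> K}) (P : Type).
Variables (O : P -> local_subring K) (CP : complete_places j O).
Hypothesis constants : forall z, (forall y, z \in subring_pred (O y)) -> exists c, z = j c.

Let jO y c : j c \in subring_pred (O y) := places_scalar CP y c.
#[local] Hint Resolve jO : core.

Variables (F w : K) (B : k -> Prop).
Hypothesis Ft : transcendental j F.
(** Infinitude of [B], in the form of Zariski density in the line. *)
Hypothesis Binf : forall q : {poly k}, q != 0 -> exists c, B c /\ q.[c] != 0.
Hypothesis fibre : forall c, B c -> exists d,
  forall y, F - j c \in nonunit (O y) -> w - j d \in nonunit (O y).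

(** Consider the ring [k[F, w, (w - d)^-1]]. A place containing it cannot lie over [F = c], since
    [w - d] vanishes there. By the centre principle [F - c] is invertible in this ring; clearing
    denominators gives the identity. *)
Lemma fibre_power c d : (forall y, F - j c \in nonunit (O y) -> w - j d \in nonunit (O y)) ->
  exists n R, (w - j d) ^+ n = (F - j c) * ev2 j F w R.
Proof.
move=> Fw; have [->|wd] := eqVneq w (j d).
  by exists 1%N, 0; rewrite ev20 subrr mulr0 expr1.
have {}wd : w - j d != 0 by rewrite subr_eq0.
have Fc : F - j c != 0.
  apply: contraTneq isT => Fc; have /eqP : 'X - c%:P = 0 by apply: Ft; rewrite !evE.
  by rewrite polyXsubC_eq0.
pose S : {pred K} := [pred z | `[< exists n R, (w - j d) ^+ n * z = ev2 j F w R >]].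
have Sc : subring_closed S.
  split=> [|a b /asboolP[n [R E]] /asboolP[n' [R' E']]
    |a b /asboolP[n [R E]] /asboolP[n' [R' E']]]; apply/asboolP.
  - by exists 0%N, 1; rewrite ev21 mulr1.
  - exists (n + n')%N, (('X - d%:P%:P) ^+ n' * R - ('X - d%:P%:P) ^+ n * R').
    by rewrite !ev2E evC -E -E' exprD; ring.
  - by exists (n + n')%N, (R * R'); rewrite !ev2E -E -E' exprD; ring.
have [|pS] := pselect (S (F - j c)^-1).
  case/asboolP => n [R E]; exists n, R.
  by rewrite -E mulrCA mulfV ?mulr1.
have [||//||y [Sy py]] := places_centre CP (A := Subring Sc) (p := F - j c).
- by move=> e; apply/asboolP; exists 0%N, e%:P%:P; rewrite !ev2E evC mul1r.
- by apply/asboolP; exists 0%N, ('X - c%:P)%:P; rewrite !ev2E !evE mul1r.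
- exact/negP.
have wdS : (w - j d)^-1 \in Subring Sc.
  by apply/asboolP; exists 1%N, 1; rewrite ev21 mulfV.
by have /nonunitP - /(_ wd)[_] := Fw y py; rewrite Sy.
Qed.

Section Minimal.
Variable M : {poly {poly k}}.
Hypotheses (M0 : M != 0) (ME : ev2 j F w M = 0).
Hypothesis Mmin : forall R, ev2 j F w R = 0 -> (size R < size M)%N -> R = 0.

(** Specialized at [F = c], the minimal relation divides [(U - d) ^+ n], so it is its leading
    coefficient times a power of [U - d]. Evaluating at [U = 0] gives the formula. *)
Lemma minimal_relation_fibre c d :
  (forall y, F - j c \in nonunit (O y) -> w - j d \in nonunit (O y)) ->
  (lead_coef M).[c] != 0 -> (M`_0).[c] = (lead_coef M).[c] * (- d) ^+ (size M).-1.
Proof.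
move=> Fw lc; have [n [R E]] := fibre_power Fw.
pose Q := ('X - d%:P%:P) ^+ n - ('X - c%:P)%:P * R : {poly {poly k}}.
have QE : ev2 j F w Q = 0 by rewrite !ev2E !evE E subrr.
(* Coefficients are only in [{poly k}], hence a pseudo-division: a power of the leading coefficient
   of [M] appears, and it stays nonzero at [c]. The remainder vanishes by minimality of [M]. *)
have divQ := Pdiv.ComRing.rdivp_eq M Q; rewrite -mul_polyC in divQ.
have mod0 : Pdiv.Ring.rmodp Q M = 0.
  apply: Mmin; last by rewrite Pdiv.Ring.ltn_rmodp.
  move/(congr1 (ev2 j F w)): divQ.
  by rewrite ev2M QE mulr0 ev2D ev2M ME mulr0 add0r.
rewrite {}mod0 addr0 in divQ.
pose h : {poly k} -> k := horner_eval c.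
have hQ : map_poly h Q = ('X - d%:P) ^+ n.
  rewrite /Q rmorphB rmorphM rmorphXn rmorphB /= map_polyX !map_polyC /=.
  by rewrite /h /horner_eval hornerC hornerXsubC subrr polyC0 mul0r subr0.
have sM : size (map_poly h M) = size M by rewrite size_map_poly_id0.
have lM : lead_coef (map_poly h M) = (lead_coef M).[c].
  by rewrite lead_coef_map_id0 // /h /horner_eval horner0.
have dvd : map_poly h M %| ('X - d%:P) ^+ n.
  have /(congr1 (map_poly h)) := divQ; rewrite !rmorphM /= hQ map_polyC /= => E1.
  have e0 : (lead_coef M ^+ Pdiv.Ring.rscalp Q M).[c] != 0 by rewrite horner_exp expf_neq0.
  rewrite -(dvdpZr _ _ e0) -mul_polyC.
  suff -> : (lead_coef M ^+ Pdiv.Ring.rscalp Q M).[c]%:P * ('X - d%:P) ^+ n =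
      map_poly h (Pdiv.Ring.rdivp Q M) * map_poly h M by exact: dvdp_mull.
  exact: E1.
have /dvdp_exp_XsubCP[m _ /eqp_eq] := dvd.
rewrite lead_coef_exp lead_coefXsubC expr1n scale1r lM => Mm.
have sm : m = (size M).-1.
  by have := sM; rewrite Mm size_scale // size_exp_XsubC => <-.
have := congr1 (fun p : {poly k} => p.[0]) Mm.
rewrite hornerZ horner_exp hornerXsubC sub0r sm horner_coef0 coef_map; exact.
Qed.

End Minimal.

(** With [n] the degree in [w] of a minimal relation [M], the functions [lead_coef M (F) w^n] and
    [(-1)^n M_0(F)] agree over almost every point of [B]. Their difference has zeros at infinitely
    many values of [F], so it is zero. *)
Lemma power_rational : exists n (l c : {poly k}),
  [/\ (0 < n)%N, l != 0 & ev j F l * w ^+ n = ev j F c].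
Proof.
have [M [M0 ME Mmin]] := minimal_relation CP w F.
have l0 : lead_coef M != 0 by rewrite lead_coef_eq0.
exists (size M).-1, (lead_coef M), ((-1) ^+ (size M).-1 *: M`_0); split=> //.
  rewrite -subn1 subn_gt0 ltnNge; apply: contra M0 => M1.
  by move: ME; rewrite (size1_polyC M1) ev2C => /Ft ->; rewrite polyC0.
rewrite -mul_polyC evM evC; set n := (size M).-1.
apply/eqP; rewrite -subr_eq0; apply: contraT => D0.
have [q [q0 qE]] := values_at_zeros CP F D0.
have [c [Bc]] := Binf (mulf_neq0 q0 l0); rewrite hornerM mulf_eq0 negb_or => /andP[qc lc].
have [d Fw] := fibre Bc.
have [y [_]] := transcendental_fibre CP Ft (q := 'X - c%:P) (eq_leq (esym (size_XsubC c))).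
rewrite !evE => Fy; case/eqP: qc; apply: (qE y) => //.
have Fc q' : ev j F q' - j q'.[c] \in nonunit (O y) by rewrite -ev_const; apply: ev_congr.
apply/(@nonunit_congr _ _ _ 0); last exact: nonunit0.
have -> : 0 = j (lead_coef M).[c] * j d ^+ n - j ((-1) ^+ n) * j (M`_0).[c].
  rewrite (minimal_relation_fibre M0 ME Mmin Fw lc) -rmorphXn -!rmorphM -rmorphB.
  by rewrite mulrCA -exprMn mulN1r opprK subrr rmorph0.
apply: congrD.
  by apply: congrM; [exact: jO|exact/rpredX/jO|exact: Fc|apply: congrX => //; exact: Fw].
by apply: congrN; apply: congrM; rewrite ?subrr ?nonunit0.
Qed.

(* [w ^+ n] is a rational function of [F] whose zeros and poles lie over
   [c0], and it is 1 at the poles of [F]: it is constant. *)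
Lemma fibre_constant_eq1 c0 : w != 0 ->
  (forall y, w \in subring_pred (O y) /\ w \notin nonunit (O y) \/ F - j c0 \in nonunit (O y)) ->
  (forall y, F \notin subring_pred (O y) -> w - 1 \in nonunit (O y)) -> w = 1.
Proof.
move=> w0 wunit wpole; have [n [l' [c' [n0 l'0 E']]]] := power_rational.
have evn0 q : q != 0 -> ev j F q != 0 by apply: contraNneq => /Ft->.
(* In lowest terms, numerator and denominator have no common zero where [F] is regular. Where [w] is
   a unit they vanish together, hence not at all. *)
have [l [c [l0 c0' cop E]]] : exists l c : {poly k},
    [/\ l != 0, c != 0, coprimep l c & ev j F l * w ^+ n = ev j F c].
  have c'0 : c' != 0.
    apply: contra_neq (mulf_neq0 (evn0 _ l'0) (expf_neq0 n w0)).
    by rewrite E' => ->; rewrite ev0.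
  have g0 : gcdp l' c' != 0 by rewrite gcdp_eq0 (negPf l'0).
  have El := divpK (dvdp_gcdl l' c'); have Ec := divpK (dvdp_gcdr l' c').
  exists (l' %/ gcdp l' c'), (c' %/ gcdp l' c'); split.
  - by apply: contraNneq l'0 => e; rewrite -El e mul0r.
  - by apply: contraNneq c'0 => e; rewrite -Ec e mul0r.
  - by rewrite coprimep_div_gcd // l'0.
  - by apply: (mulfI (evn0 _ g0)); rewrite mulrA -!evM ![gcdp _ _ * _]mulrC El Ec.
have notboth y : F \in subring_pred (O y) ->
    ev j F l \in nonunit (O y) -> ev j F c \notin nonunit (O y).
  move=> Fy ly; apply/negP => cy.
  have /Bezout_eq1_coprimepP[[u v] /= /(congr1 (ev j F))] := cop.
  rewrite !evE => uv; move/negP: (nonunit1 (O y)); apply; rewrite -uv.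
  by apply: nonunitD; apply: nonunitMl => //; exact: ev_sub.
have wn y : w \in subring_pred (O y) -> w \notin nonunit (O y) ->
    ev j F l \in nonunit (O y) <-> ev j F c \in nonunit (O y).
  move=> wy wny; rewrite -E; split=> h; first by apply: nonunitMr => //; exact: rpredX.
  have wn0 : w ^+ n != 0 by rewrite expf_neq0.
  rewrite -[ev j F l](mulfK wn0); apply: nonunitMr => //.
  by rewrite -exprVn rpredX // nonunitV.
(* A polynomial in [F] that vanishes only over [c0] is a constant times a power of [F - c0]: a
   further nonconstant factor would vanish somewhere by [transcendental_fibre]. *)
have split_root (q : {poly k}) : q != 0 -> (forall y, F \in subring_pred (O y) ->
    ev j F q \in nonunit (O y) -> F - j c0 \in nonunit (O y)) ->
    exists i a, a != 0 /\ ev j F q = j a * (F - j c0) ^+ i.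
  move=> q0 qy; have [i [r]] := multiplicity_XsubC q c0; rewrite q0 /= => rc Eq.
  have r1 : (size r <= 1)%N.
    rewrite leqNgt; apply/negP => r1; have [y [Fy ry]] := transcendental_fibre CP Ft r1.
    have : F - j c0 \in nonunit (O y).
      by apply: qy => //; rewrite Eq evM mulrC; apply: nonunitMl => //; exact: ev_sub.
    move=> Fc; case/negP: rc; apply/rootP; apply: (scalar_nonunit (jO y)).
    rewrite -ev_const; apply/(nonunit_congr (a := ev j F r)) => //.
    exact: ev_congr.
  exists i, r`_0; split; last by rewrite {1}Eq {1}(size1_polyC r1) !evE.
  by apply: contraNneq q0 => r0; rewrite Eq (size1_polyC r1) r0 polyC0 mul0r.
have wl y : F \in subring_pred (O y) ->
    ev j F l \in nonunit (O y) -> F - j c0 \in nonunit (O y).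
  move=> Fy ly; case: (wunit y) => // -[wy wny].
  by case/negP: (notboth y Fy ly); apply/(wn y).
have wc y : F \in subring_pred (O y) ->
    ev j F c \in nonunit (O y) -> F - j c0 \in nonunit (O y).
  move=> Fy cy; case: (wunit y) => // -[wy wny].
  by have /(wn y wy wny)/(notboth y Fy)/negP := cy.
have [i [a [a0 Ea]]] := split_root _ l0 wl; have [i' [b [b0 Eb]]] := split_root _ c0' wc.
have [y Fy] : exists y, F \notin subring_pred (O y).
  apply: contrapT => nF; have [|c1 Fc1] := @constants F.
    by move=> y; apply: contraT => Fy; case: nF; exists y.
  have /eqP : 'X - c1%:P = 0 by apply: Ft; rewrite !evE Fc1 subrr.
  by rewrite polyXsubC_eq0.
have w1 := wpole y Fy; have wy : w \in subring_pred (O y) := congr_sub (rpred1 _) w1.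
have wn1 : w ^+ n - 1 \in nonunit (O y) by rewrite -[X in _ - X](expr1n _ n) congrX ?rpred1.
set t := F - j c0 in Ea Eb *.
have ty : t \notin subring_pred (O y).
  apply: contra Fy => ty; rewrite -[F](subrK (j c0)).
  by apply: rpredD; [exact: ty|exact: jO].
have t0 : t != 0 by apply: contraNneq ty => ->; exact: rpred0.
have tV := valuation_nonunitV (places_valuation CP y) ty.
have tX m : t^-1 ^+ m.+1 \in nonunit (O y) by rewrite exprS nonunitMr // rpredX // nonunit_sub.
have {}E : j a * t ^+ i * w ^+ n = j b * t ^+ i' by rewrite -Ea E.
(* At the pole [y] of [F] both [t^-1] and [w ^+ n - 1] vanish, so unequal exponents would force [a]
   or [b] to be zero. *)
have [lt_i|lt_i|eq_i] := ltngtP i i'.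
- have [m Em] : exists m, i' = (m.+1 + i)%N.
    by exists (i' - i).-1; rewrite prednK ?subn_gt0 // subnK // ltnW.
  have : j b = j a * w ^+ n * t^-1 ^+ m.+1.
    have := E; rewrite Em exprD exprVn => Em'.
    apply: (mulIf (expf_neq0 i t0)); apply: (mulIf (expf_neq0 m.+1 t0)).
    rewrite -mulrA [t ^+ i * _]mulrC -Em'; field; exact: expf_neq0.
  move=> jb; have /(scalar_nonunit (jO y))/eqP : j b \in nonunit (O y).
    by rewrite jb; apply: nonunitMl (tX m); apply: rpredM (jO _ _) _; exact: rpredX.
  by rewrite (negPf b0).
- have [m Em] : exists m, i = (m.+1 + i')%N.
    by exists (i - i').-1; rewrite prednK ?subn_gt0 // subnK // ltnW.
  have jaw : j a * w ^+ n = j b * t^-1 ^+ m.+1.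
    have := E; rewrite Em exprD exprVn => Em'.
    apply: (mulIf (expf_neq0 i' t0)); apply: (mulIf (expf_neq0 m.+1 t0)).
    rewrite [LHS](_ : _ = j a * (t ^+ m.+1 * t ^+ i') * w ^+ n); last by ring.
    by rewrite Em'; field; exact: expf_neq0.
  have /(scalar_nonunit (jO y))/eqP : j a \in nonunit (O y).
    have : j a * w ^+ n \in nonunit (O y) by rewrite jaw; exact: nonunitMl (jO _ _) (tX m).
    move/(nonunit_congr (b := j a)); apply; rewrite -{2}[j a]mulr1.
    by apply: congrM => //; rewrite ?rpred1 // subrr nonunit0.
  by rewrite (negPf a0).
have ja0 : j a != 0 by rewrite fmorph_eq0.
have jab : w ^+ n = j (b / a).
  rewrite fmorph_div; apply: (mulfI ja0); apply: (mulIf (expf_neq0 i t0)).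
  by rewrite mulrAC E eq_i mulrCA mulfV // mulr1.
have ba1 : b / a = 1.
  by apply: (scalar_congr (jO y)); rewrite rmorph1 -jab.
rewrite ba1 rmorph1 in jab.
(* A pole of [w] would contradict [w ^+ n = 1]; hence [w] is a constant, and its value at [y] is
   1. *)
have [z|c1 Ec1] := @constants w; last first.
  by rewrite Ec1 (_ : c1 = 1) ?rmorph1 //; apply: (scalar_congr (jO y)); rewrite rmorph1 -Ec1.
apply: contraT => wz; have := valuation_nonunitV (places_valuation CP z) wz.
move=> h; have := nonunit1 (O z); rewrite -invr1 -jab -exprVn -(prednK n0) exprS.
by rewrite nonunitMr // rpredX // nonunit_sub.
Qed.

End FibreConstant.

(** * Closed points of a smooth curve *)

Section DiscreteValuation.
Variables (K : fieldType) (A : local_subring K).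

(** The last clause excludes nonzero elements divisible by every power of [p]; noetherianity will
    supply it. *)
Definition uniformizer (p : K) : Prop :=
  [/\ p != 0,
      (forall a, a \in nonunit A <-> exists2 b, b \in subring_pred A & a = p * b) &
      forall z, z != 0 -> exists (n : int) u,
        [/\ u \in subring_pred A, u \notin nonunit A & z = u * p ^ n]].

Lemma unit_mul u a : u \in subring_pred A -> u \notin nonunit A ->
  (u * a \in subring_pred A) = (a \in subring_pred A) /\
  (u * a \in nonunit A) = (a \in nonunit A).
Proof.
move=> uA un; have u0 : u != 0 by apply: contraNneq un => ->; exact: nonunit0.
have uV := nonunitV uA un.
split; apply/idP/idP => h.
- by rewrite -[a](mulKf u0) rpredM.
- exact: rpredM.
- by rewrite -[a](mulKf u0) nonunitMl.
- exact: nonunitMl.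
Qed.

Lemma pos_power p (n : nat) : p \in nonunit A -> p ^+ n.+1 \in nonunit A.
Proof. by move=> pn; rewrite exprS nonunitMr // rpredX // nonunit_sub. Qed.

(** Translates signs of orders into membership in the ring and in its maximal ideal, the language of
    all later arguments. *)
Lemma is_ord_sign f n : is_ord A f n -> f != 0 /\
  [/\ (f \in nonunit A) = (0 < n)%R, (f \in subring_pred A) = (0 <= n)%R &
      (f^-1 \in subring_pred A) = (n <= 0)%R].
Proof.
move=> [p [u [p0 pA [uA un] ->]]].
have u0 : u != 0 by apply: contraNneq un => ->; exact: nonunit0.
have pn : p \in nonunit A by apply/pA; exists 1; rewrite ?rpred1 ?mulr1.
have [uVA uVn] : u^-1 \in subring_pred A /\ u^-1 \notin nonunit A.
  split; first exact: nonunitV.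
  by apply/negP => /nonunitP; rewrite invr_eq0 invrK uA => /(_ u0)[].
split; first by rewrite mulf_neq0 // expfz_neq0.
rewrite invfM; have [-> ->] := unit_mul (p ^ n) uA un.
have [-> _] := unit_mul (p ^ n)^-1 uVA uVn.
case: n => [[|n]|n].
- by rewrite expr0z invr1 rpred1 (negPf (nonunit1 A)).
- have /= h := pos_power n pn; rewrite -exprnP; rewrite h (nonunit_sub h).
  have pn0 : p ^+ n.+1 != 0 by rewrite expf_neq0.
  by have /nonunitP - /(_ pn0)[_ /negPf ->] := h.
- have /= h := pos_power n pn; rewrite NegzE -exprnN invrK (nonunit_sub h).
  have pn0 : p ^+ n.+1 != 0 by rewrite expf_neq0.
  have /nonunitP - /(_ pn0)[_ /negPf pV] := h.
  have -> : (p ^- n.+1 \in nonunit A) = false.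
    by apply/negP => /nonunit_sub; rewrite pV.
  by rewrite pV.
Qed.

Variable p : K.
Hypothesis pU : uniformizer p.

Lemma uniformizer_nonunit : p \in nonunit A /\ p != 0.
Proof. by case: pU => p0 pA _; split=> //; apply/pA; exists 1; rewrite ?rpred1 ?mulr1. Qed.

Lemma uniformizer_is_ord z : z != 0 -> exists n, is_ord A z n.
Proof.
case: pU => p0 pA pz /pz[n [u [uA un ->]]].
by exists n, p, u; split.
Qed.

Lemma uniformizer_valuation : is_valuation_ring A.
Proof.
move=> z; have [->|z0] := eqVneq z 0; first by left; exact: rpred0.
have [n /is_ord_sign[_ [_ -> ->]]] := uniformizer_is_ord z0.
by case: (lerP 0 n) => h; [left|right; exact: ltW].
Qed.

Lemma uniformizer_rank_one q z : q \in nonunit A -> q != 0 ->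
  exists n, q ^+ n * z \in subring_pred A.
Proof.
move=> qA q0; have [->|z0] := eqVneq z 0; first by exists 0%N; rewrite mulr0 rpred0.
case: pU => p0 pA pz; have [pn _] := uniformizer_nonunit.
have [[n|n] [u [uA un Ez]]] := pz z z0.
  by exists 0%N; rewrite mul1r Ez -exprnP rpredM // rpredX // nonunit_sub.
have /pA[b bA Eq] := qA; exists n.+1.
rewrite Ez Eq NegzE -exprnN exprMn_comm; last exact: mulrC.
rewrite (_ : _ * _ = b ^+ n.+1 * u); last by field; exact: expf_neq0.
by rewrite rpredM // rpredX.
Qed.

End DiscreteValuation.

(** * Noetherian local subrings with principal maximal ideal *)

Section SubringUnits.
Variables (K : fieldType) (A : local_subring K).

Lemma subring_valX (a : subring_type A) n : subring_val (a ^+ n) = subring_val a ^+ n.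
Proof. by elim: n => [|n IH]; rewrite ?expr0 // !exprS -IH. Qed.

Lemma is_unit_subring (a : subring_type A) :
  is_unit (a : GRing.ComPzRing.sort _) <-> subring_val a \notin nonunit A.
Proof.
split=> [[b /(congr1 (@subring_val _ _)) /= ab]|an].
  have a0 : subring_val a != 0.
    by apply: contraTneq isT => a0; move/eqP: ab; rewrite a0 mul0r eq_sym oner_eq0.
  apply/negP => /nonunitP - /(_ a0)[_ /negP]; apply.
  by rewrite -[(_)^-1]mulr1 -ab mulKf //; exact: subring_valP.
exists (SubringElt (nonunitV (subring_valP a) an)); apply: val_inj => /=.
by rewrite mulfV //; apply: contraNneq an => ->; exact: nonunit0.
Qed.

Lemma nonunit_prime : is_prime [set a : subring_type A | ~ is_unit a].
Proof.
have nuE (a : subring_type A) : ~ is_unit a <-> subring_val a \in nonunit A.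
  rewrite is_unit_subring; split=> [/negP|h]; first by rewrite negbK.
  by rewrite h.
split=> [|/=|a b /=].
- split=> [|a b|a b] /=; rewrite !nuE /=.
  + exact: nonunit0.
  + exact: nonunitD.
  + by apply: nonunitMl; exact: subring_valP.
- by rewrite nuE => /=; apply/negP; exact: nonunit1.
- rewrite !nuE; exact: nonunit_mul (subring_valP a) (subring_valP b).
Qed.

Lemma id_localization (R : comPzRingType) :
  is_localization [set a : R | ~ is_unit a] (idfun : {rmorphism R -> R}).
Proof.
split=> /= [s /contrapT //|b|a ->]; last first.
  by exists 1; rewrite mulr0; split=> // -[]; exists 1; rewrite mulr1.
by exists b, 1; rewrite mulr1; split=> // -[]; exists 1; rewrite mulr1.
Qed.

Lemma noetherian_uniformizer (p : subring_type A) :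
  is_noetherian (subring_type A) -> p != 0 ->
  (forall z, exists a b : subring_type A,
     subring_val b != 0 /\ z = subring_val a / subring_val b) ->
  (forall a : subring_type A, subring_val a \in nonunit A <-> exists b, a = p * b) ->
  uniformizer A (subring_val p).
Proof.
move=> noeth p0 frac pA; have vp0 : subring_val p != 0 by [].
have pn : subring_val p \in nonunit A by apply/pA; exists 1; rewrite mulr1.
have pA' a : a \in nonunit A <-> exists2 b, b \in subring_pred A & a = subring_val p * b.
  split=> [aA|[b bA ->]]; last by rewrite nonunitMr.
  have /pA[b /(congr1 (@subring_val _ _)) /= E] :
    subring_val (SubringElt (nonunit_sub aA)) \in nonunit A by [].
  by exists (subring_val b) => //; exact: subring_valP.
have bounded (a : subring_type A) : a != 0 -> exists n, ~ exists b, a = p ^+ n * b.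
  move=> a0; apply: contrapT => /forallNP h.
  have {}h n : exists b, a = p ^+ n * b by apply: contrapT => hn; apply: (h n).
  (* The increasing union of the ideals [(a : p^n)]. Being finitely generated, it equals one of
     them; then [a = p^(n+1) b] with [p^n b = a r] gives [a = a p r], so [p] would be a unit. *)
  pose I := [set b : subring_type A | exists n r, p ^+ n * b = a * r].
  have IS : is_ideal I.
    split; first by exists 0%N, 0; rewrite !mulr0.
      move=> b c [n [r Eb]] [m [s Ec]]; exists (n + m)%N, (p ^+ m * r + p ^+ n * s).
      rewrite mulrDr [in LHS]exprD mulrDr [a * _]mulrCA -Eb [a * _]mulrCA -Ec; ring.
    by move=> b c [n [r Ec]]; exists n, (b * r); rewrite mulrCA Ec mulrCA.
  have [s Is] := noeth I IS.
  have [n nE] : exists n, forall b, b \in s -> exists r, p ^+ n * b = a * r.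
    have: forall b, b \in s -> I b by move=> b bs; rewrite Is => J _; apply.
    elim: s {Is} => [_|b s IH bI]; first by exists 0%N.
    have [n nE] := IH (fun c cs => bI c (mem_behead (s := b :: s) cs)).
    have [m [r Eb]] := bI b (mem_head _ _).
    exists (n + m)%N => c; rewrite inE => /predU1P[->|/nE[t Et]].
      by exists (p ^+ n * r); rewrite exprD -mulrA Eb mulrCA.
    by exists (p ^+ m * t); rewrite exprD mulrAC [p ^+ n * c]Et -mulrA [t * _]mulrC.
  have [b Eb] := h n.+1.
  have [r Er] : exists r, p ^+ n * b = a * r.
    have : ideal_gen s b by rewrite -Is; exists n.+1, 1; rewrite mulr1 -Eb.
    move/(_ [set c | exists r, p ^+ n * c = a * r]); apply=> //; split.
    - by exists 0; rewrite !mulr0.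
    - by move=> c d [r Er] [t Et]; exists (r + t); rewrite !mulrDr Er Et.
    - by move=> c d [r Er]; exists (c * r); rewrite mulrCA Er mulrCA.
  have ap : a = a * (p * r) by rewrite mulrCA -Er mulrA -exprS -Eb.
  have vr : subring_val p * subring_val r = 1.
    apply: (mulfI (_ : subring_val a != 0)) => //.
    by rewrite mulr1 -[in RHS]/(subring_val a) [in RHS]ap.
  by have := nonunit1 A; rewrite -vr nonunitMr //; exact: subring_valP.
have factor (a : subring_type A) : a != 0 -> exists (n : nat) u,
    [/\ u \in subring_pred A, u \notin nonunit A & subring_val a = u * subring_val p ^+ n].
  move=> a0; have [n] := bounded a a0; elim: n => [|n IH] h.
    by case: h; exists a; rewrite mul1r.
  have [[b Eb]|] := pselect (exists b, a = p ^+ n * b); last exact: IH.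
  exists n, (subring_val b); split; first exact: subring_valP.
    apply/negP => /pA[c Ec]; apply: h; exists c.
    by rewrite exprSr -mulrA -Ec.
  by rewrite Eb mulrC /= subring_valX.
split=> // z z0; have [a [b [b0 Ez]]] := frac z.
have a0 : a != 0 by apply: contraNneq z0 => a0; rewrite Ez a0 mul0r.
have [n [u [uA un Eu]]] := factor a a0; have [m [v [vA vn Ev]]] := factor b b0.
have v0 : v != 0 by apply: contraNneq vn => ->; exact: nonunit0.
exists (n%:Z - m%:Z), (u / v); split; first by rewrite rpredM // nonunitV.
  apply/negP => h; have := nonunitMl vA h; rewrite mulrCA mulfV // mulr1.
  exact/negP.
rewrite Ez Eu Ev expfzDr // -exprnN -exprnP; field.
by rewrite v0 /= expf_neq0.
Qed.

End SubringUnits.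

Local Notation scalar := Defs.scalar.

(** * Stalks of a variety and the places of a proper smooth curve *)

Section Varieties.
Variables (k : fieldType) (X : variety k).
Local Notation K := (function_field X).
Implicit Types (x y : pt X) (g : seq K) (a b z : K).
Local Notation gen := (alg_gen (scalar X)).

Lemma alg_gen_scalar g t : gen g (scalar X t). Proof. by move=> A h _. Qed.

Lemma alg_gen1 g : gen g 1. Proof. by move=> A _ _; exact: rpred1. Qed.

Lemma alg_genB g a b : gen g a -> gen g b -> gen g (a - b).
Proof. by move=> ha hb A h1 h2; apply: rpredB; [exact: ha|exact: hb]. Qed.

Lemma alg_genD g a b : gen g a -> gen g b -> gen g (a + b).
Proof. by move=> ha hb A h1 h2; apply: rpredD; [exact: ha|exact: hb]. Qed.

Lemma alg_genM g a b : gen g a -> gen g b -> gen g (a * b).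
Proof. by move=> ha hb A h1 h2; apply: rpredM; [exact: ha|exact: hb]. Qed.

Lemma stalk_chart x : exists g (P : set K), [/\
  forall z, exists a b, [/\ gen g a, gen g b, b != 0 & z = a / b],
  alg_prime (scalar X) g P,
  forall z, z \in subring_pred (stalk x) <-> alg_localization (scalar X) g P z &
  forall Q, alg_prime (scalar X) g Q -> exists y,
    forall z, z \in subring_pred (stalk y) <-> alg_localization (scalar X) g Q z].
Proof.
have [charts [frac cover all]] := variety_charts X.
have [g [P [gc gP E]]] := cover x; exists g, P; split=> //.
- exact: frac.
- by move=> z; rewrite -E.
- by move=> Q /(all _ _ gc)[y Ey]; exists y => z; rewrite -Ey.
Qed.

Lemma gen_localization g (P : set K) a : alg_prime (scalar X) g P -> gen g a ->
  alg_localization (scalar X) g P a.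
Proof.
move=> [_ [_ P1] _ _ _] ga; exists a, 1; split=> //; first exact: alg_gen1.
by rewrite divr1.
Qed.

Lemma scalar_stalk x t : scalar X t \in subring_pred (stalk x).
Proof.
have [g [P [_ gP E _]]] := stalk_chart x.
apply/E; exact: gen_localization gP (@alg_gen_scalar g t).
Qed.

Lemma stalk_frac x z : exists a b : subring_type (stalk x),
  subring_val b != 0 /\ z = subring_val a / subring_val b.
Proof.
have [g [P [frac gP E _]]] := stalk_chart x.
have gx a : gen g a -> a \in subring_pred (stalk x) by move/(gen_localization gP)/E.
have [a [b [/gx ga /gx gb b0 Ez]]] := frac z.
by exists (SubringElt ga), (SubringElt gb).
Qed.

Lemma subring_val_scalar_in x t :
  subring_val (scalar_in (stalk x) t) = scalar X t.
Proof. by apply: (insubdK (0 : subring_type (stalk x))); exact: scalar_stalk. Qed.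

Fact scalar_in_zmod x : zmod_morphism (scalar_in (stalk x)).
Proof. by move=> s t; apply: val_inj; rewrite /= !subring_val_scalar_in rmorphB. Qed.

Fact scalar_in_monoid x : monoid_morphism (scalar_in (stalk x)).
Proof.
split=> [|s t]; apply: val_inj; rewrite /= !subring_val_scalar_in; first exact: rmorph1.
exact: rmorphM.
Qed.

HB.instance Definition _ x := GRing.isZmodMorphism.Build k (subring_type (stalk x))
  (scalar_in (stalk x)) (@scalar_in_zmod x).
HB.instance Definition _ x := GRing.isMonoidMorphism.Build k (subring_type (stalk x))
  (scalar_in (stalk x)) (@scalar_in_monoid x).

(** Smoothness is applied to the trivial base change: the stalk is its own tensor product with [k],
    and its own localization at the maximal ideal. *)
Lemma smooth_regular x : is_smooth X -> is_regular_local (subring_type (stalk x)).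
Proof.
move=> smooth.
have tens : is_tensor (scalar_in (stalk x)) (idfun : {rmorphism k -> k})
    (idfun : {rmorphism subring_type (stalk x) -> subring_type (stalk x)})
    (scalar_in (stalk x) : {rmorphism k -> subring_type (stalk x)}).
  split=> // S f h fh; exists f; split; first by split.
  by move=> h' h'f _ a; exact: h'f.
by apply: (smooth x _ _ _ _ _ tens _ (nonunit_prime (stalk x))); exact: id_localization.
Qed.

Section Contraction.
Variables (x : pt X) (g : seq K) (P : set K).
Hypothesis gP : alg_prime (scalar X) g P.
Hypothesis xE : forall z, z \in subring_pred (stalk x) <-> alg_localization (scalar X) g P z.

Definition contraction (Q : set (subring_type (stalk x))) : set K :=
  [set a | gen g a /\ exists2 b, Q b & subring_val b = a].

Lemma contraction_prime Q : is_prime Q -> alg_prime (scalar X) g (contraction Q).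
Proof.
have gx a : gen g a -> a \in subring_pred (stalk x) by move/(gen_localization gP)/xE.
move=> [[Q0 QD QM] Q1 Qp]; split.
- by move=> a [].
- split; first by split; [rewrite -(subrr 1); apply: alg_genB; exact: alg_gen1|exists 0].
  by move=> [_ [b Qb b1]]; apply: Q1; rewrite (_ : 1 = b) //; apply: val_inj; rewrite /= b1.
- move=> a b [ga [a' Qa Ea]] [gb [b' Qb Eb]]; split; first exact: alg_genD ga gb.
  by exists (a' + b'); [exact: QD|rewrite /= Ea Eb].
- move=> a b ga [gb [b' Qb Eb]]; split; first exact: alg_genM ga gb.
  by exists (SubringElt (gx _ ga) * b'); [exact: QM|rewrite /= Eb].
- move=> a b ga gb [_ [c Qc cE]].
  have /Qp : Q (SubringElt (gx _ ga) * SubringElt (gx _ gb)).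
    by rewrite (_ : _ * _ = c) //; apply: val_inj; rewrite /= cE.
  by case=> [Qa|Qb]; [left|right]; split=> //;
    [exists (SubringElt (gx _ ga))|exists (SubringElt (gx _ gb))].
Qed.

(** Turns chains of primes of a stalk into chains of specializations. The inclusion is strict
    because some numerator [a] lies in the contraction of [Q'] but not in that of [Q]: then [a^-1]
    is regular at [y] and not at [y']. *)
Lemma contraction_specializes (Q Q' : set (subring_type (stalk x))) y y' :
  is_prime Q -> is_prime Q' -> Q `<` Q' ->
  (forall z, z \in subring_pred (stalk y) <-> alg_localization (scalar X) g (contraction Q) z) ->
  (forall z, z \in subring_pred (stalk y') <-> alg_localization (scalar X) g (contraction Q') z) ->
  specializes y y' /\ y' <> y.
Proof.
have gx a : gen g a -> a \in subring_pred (stalk x) by move/(gen_localization gP)/xE.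
move=> Qp Q'p [QQ' Q'Q] yE y'E; split.
  move=> z /y'E[a [b [ga gb bQ ->]]]; apply/yE; exists a, b; split=> //.
  by move=> [_ [b' Qb E]]; apply: bQ; split=> //; exists b' => //; exact: QQ'.
have [z Q'z Qz] : exists2 z, Q' z & ~ Q z.
  by apply: contrapT => h; apply: Q'Q => z Q'z; apply: contrapT => Qz; apply: h; exists z.
have /xE[a [b [ga gb bP Ez]]] := subring_valP z.
have b0 : b != 0 by apply: contra_notN bP => /eqP->; case: gP => _ [].
have bV : b^-1 \in subring_pred (stalk x).
  by apply/xE; exists 1, b; rewrite mul1r; split=> //; exact: alg_gen1.
case: Qp (Q'p) => [[Q0 _ QM] _ _] [[_ _ Q'M] _ _].
have aQ' : contraction Q' a.
  split=> //; exists (SubringElt (gx _ gb) * z); first exact: Q'M.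
  by rewrite /= Ez mulrCA mulfV // mulr1.
have aQ : ~ contraction Q a.
  move=> [_ [a' Qa' Ea]]; apply: Qz.
  rewrite (_ : z = SubringElt bV * a'); first exact: QM.
  by apply: val_inj; rewrite /= Ez Ea mulrC.
have a0 : a != 0.
  apply: contra_notN aQ => /eqP ->; split; last by exists 0.
  by rewrite -(subrr 1); apply: alg_genB; exact: alg_gen1.
move=> yy; have : a^-1 \in subring_pred (stalk y).
  by apply/yE; exists 1, a; rewrite mul1r; split=> //; exact: alg_gen1.
rewrite -yy => /y'E[c [d [gc gd dQ E]]]; apply: dQ.
have d0 : d != 0.
  by apply: contraTneq isT => d0; move: (invr_neq0 a0); rewrite E d0 invr0 mulr0 eqxx.
have -> : d = c * a.
  by rewrite -[c](mulfVK d0) -E mulrAC mulVf // mul1r.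
by have [_ _ _ h _] := contraction_prime Q'p; exact: h.
Qed.

End Contraction.

Hypotheses (smoothX : is_smooth X) (curveX : dimension_one X).

Lemma no_prime_chain2 x d (P : nat -> set (subring_type (stalk x))) :
  (1 < d)%N -> ~ prime_chain d P.
Proof.
move=> d1 [Pp Plt]; have [g [Q [_ gQ E pts]]] := stalk_chart x.
have P0 : is_prime (P 0%N) by exact: Pp.
have P1 : is_prime (P 1%N) by apply: Pp; exact: ltnW.
have P2 : is_prime (P 2%N) by exact: Pp.
have [y0 E0] := pts _ (contraction_prime gQ E P0).
have [y1 E1] := pts _ (contraction_prime gQ E P1).
have [y2 E2] := pts _ (contraction_prime gQ E P2).
have [s01 n01] := contraction_specializes gQ E P0 P1 (Plt _ (ltnW d1)) E0 E1.
have [s12 n12] := contraction_specializes gQ E P1 P2 (Plt _ d1) E1 E2.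
by case: curveX => _; apply; exists y0, y1, y2; split.
Qed.

(** A regular local ring of dimension at most one is a field, here the whole function field, or a
    discrete valuation ring. *)
Lemma stalk_cases x : (forall z, z \in subring_pred (stalk x)) \/
  exists p, uniformizer (stalk x) p.
Proof.
have [_ noeth [s [[[P chain] _] sE]]] := smooth_regular x smoothX.
have nuE (a : subring_type (stalk x)) : ideal_gen s a <-> subring_val a \in nonunit (stalk x).
  rewrite sE /= is_unit_subring; split=> [/negP|h]; first by rewrite negbK.
  by rewrite h.
have field_case : (forall a, a \in nonunit (stalk x) -> a = 0) ->
    forall z, z \in subring_pred (stalk x).
  move=> nu0 z; have [a [b [b0 ->]]] := stalk_frac x z.
  apply: rpredM; first exact: subring_valP.
  apply: nonunitV; first exact: subring_valP.
  by apply: contra b0 => /nu0 ->.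
(* By regularity the number of generators is the Krull dimension, so two generators would give a
   chain of three primes. *)
case: s chain sE nuE => [|p [|q s]] chain sE nuE; last by case: (no_prime_chain2 _ chain).
  left; apply: field_case => a aN.
  have /nuE : subring_val (SubringElt (nonunit_sub aN)) \in nonunit (stalk x) by [].
  move/(_ [set 0]) => h; suff /(congr1 (@subring_val _ _)) : SubringElt (nonunit_sub aN) = 0 by [].
  apply: h => //; split=> //= [b c -> ->|b c ->]; first by rewrite addr0.
  by rewrite mulr0.
have nuE' (a : subring_type (stalk x)) :
    subring_val a \in nonunit (stalk x) <-> exists r, a = p * r.
  rewrite -nuE; split.
    move/(_ [set s | exists r, s = p * r]); apply; last first.
      by move=> b; rewrite inE => /eqP->; exists 1; rewrite mulr1.
    split; first by exists 0; rewrite mulr0.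
      by move=> _ _ [b ->] [c ->]; exists (b + c); rewrite mulrDr.
    by move=> b _ [c ->]; exists (b * c); rewrite mulrCA.
  move=> [b ->] I [_ _ IM] Is; rewrite mulrC; apply: IM; apply: Is; exact: mem_head.
have [p0|p0] := eqVneq p 0.
  left; apply: field_case => a aN.
  have /nuE'[b] : subring_val (SubringElt (nonunit_sub aN)) \in nonunit (stalk x) by [].
  by rewrite p0 mul0r => /(congr1 (@subring_val _ _)).
by right; exists (subring_val p); apply: noetherian_uniformizer => //; exact: stalk_frac.
Qed.

Lemma closed_uniformizer x : closed_points X x -> exists p, uniformizer (stalk x) p.
Proof.
move=> xc; case: (stalk_cases x) => // xK; case: curveX => [[y [z [_ zy]]] _].
have xall w : w = x by apply: xc => a _; exact: xK.
by case: zy; rewrite (xall y) (xall z).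
Qed.

(** A valuation ring of rank one is maximal among proper subrings of the field. A stalk contained in
    [O_x] is itself such a ring, hence equals [O_x], and separatedness identifies the two points. *)
Lemma uniformizer_closed x p : uniformizer (stalk x) p -> closed_points X x.
Proof.
move=> pU y xy; have [pn p0] := uniformizer_nonunit pU.
have /nonunitP - /(_ p0)[_ /negP pV] := pn.
have [q qU] : exists q, uniformizer (stalk y) q.
  by case: (stalk_cases y) => // yK; case: pV; exact: xy.
have yx : {subset subring_pred (stalk x) <= subring_pred (stalk y)}.
  move=> z zx; apply: contraT => zy; case: pV.
  have zN := valuation_nonunitV (uniformizer_valuation qU) zy.
  have z0 : z != 0 by apply: contraNneq zy => ->; exact: rpred0.
  have [n /xy h] := uniformizer_rank_one qU p^-1 zN (invr_neq0 z0).
  have -> : p^-1 = z ^+ n * (z^-1 ^+ n * p^-1) by rewrite exprVn mulVKf // expf_neq0.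
  by rewrite rpredM // rpredX.
have eqxy : subring_pred (stalk x) =i subring_pred (stalk y).
  by move=> z; apply/idP/idP; [exact: yx|exact: xy].
apply: (variety_separated (uniformizer_valuation pU)).
- exact: scalar_stalk.
- split=> [|z]; first exact: xy.
  by rewrite !inE !eqxy.
- by split.
Qed.

Hypothesis properX : is_proper X.

(** For the centre principle, a valuation ring containing [A] but not [p^-1] dominates some [O_x] by
    properness. This [O_x] is not the whole field, so it is a discrete valuation ring and equals the
    valuation ring. *)
Lemma curve_places : complete_places (scalar X)
  (fun x : {x | closed_points X x} => stalk (sval x)).
Proof.
split.
- by move=> x c; exact: scalar_stalk.
- by move=> [x /= /closed_uniformizer[p /uniformizer_valuation]].
- by move=> [x /= /closed_uniformizer[p pU]] q z qn q0; exact: (uniformizer_rank_one pU z qn q0).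
- move=> A p jA pA p0 pV; have [V [Vval AV pVV]] := valuation_overring pA pV.
  have [x [xV xVn]] := properX Vval (fun t => AV _ (jA t)).
  have [q qU] : exists q, uniformizer (stalk x) q.
    by case: (stalk_cases x) => // xK; case/negP: pVV; exact: xV.
  have Vx : {subset subring_pred V <= subring_pred (stalk x)}.
    move=> z zV; apply: contraT => zx.
    have z0 : z != 0 by apply: contraNneq zx => ->; exact: rpred0.
    have /xVn/nonunitP := valuation_nonunitV (uniformizer_valuation qU) zx.
    by rewrite invrK zV => /(_ (invr_neq0 z0))[].
  exists (exist _ x (uniformizer_closed qU)) => /=; split; first by move=> a /AV/Vx.
  by apply/nonunitP => //; split; [exact/Vx/AV|apply: contra pVV; exact: xV].
Qed.

Lemma ord_sign x f : closed_points X x -> f != 0 ->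
  [/\ (f \in nonunit (stalk x)) = (0 < ord x f)%R,
      (f \in subring_pred (stalk x)) = (0 <= ord x f)%R &
      (f^-1 \in subring_pred (stalk x)) = (ord x f <= 0)%R].
Proof.
move=> /closed_uniformizer[p pU] f0; have [n nf] := uniformizer_is_ord pU f0.
by have /is_ord_sign[] : is_ord (stalk x) f (ord x f) by apply: (xgetPex 0); exists n.
Qed.

Lemma value_eqP x a b : a \in subring_pred (stalk x) -> b \in subring_pred (stalk x) ->
  value x a = value x b <-> a - b \in nonunit (stalk x).
Proof.
move=> ax bx; rewrite /value /residue_class.
have -> : (a - b \in nonunit (stalk x)) =
    ((insubd 0 a : subring_type (stalk x)) - insubd 0 b \in @max_ideal _ (stalk x)).
  have iK c : c \in subring_pred (stalk x) ->
      subring_val (insubd (0 : subring_type (stalk x)) c) = c.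
    by move=> cx; apply: (insubdK (0 : subring_type (stalk x))).
  rewrite -[RHS]/(subring_val (insubd (0 : subring_type (stalk x)) a) -
    subring_val (insubd (0 : subring_type (stalk x)) b) \in nonunit (stalk x)).
  by rewrite !iK.
by rewrite ring_quotient.Quotient.idealrBE; split=> [->|/eqP].
Qed.

End Varieties.

(** * Rational points and semilocal units *)

Lemma poly_roots_seq (k : fieldType) (q : {poly k}) : q != 0 ->
  exists rs : seq k, forall c, q.[c] = 0 -> c \in rs.
Proof.
move: {2}(size q) (leqnn (size q)) => n; elim: n q => [|n IH] q sq q0.
  by move: sq; rewrite leqn0 size_poly_eq0 (negPf q0).
have [[c /rootP/factor_theorem[r Er]]|nr] := pselect (exists c, q.[c] = 0); last first.
  by exists [::] => c qc; case: nr; exists c.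
have r0 : r != 0 by apply: contraNneq q0 => r0; rewrite Er r0 mul0r.
have sr : (size r <= n)%N by move: sq; rewrite Er size_Mmonic ?monicXsubC // size_XsubC addn2.
have [rs rsE] := IH r sr r0; exists (c :: rs) => d /eqP.
rewrite Er hornerM hornerXsubC mulf_eq0 subr_eq0 inE => /orP[/eqP/rsE->|->//].
by rewrite orbT.
Qed.

Section RationalPoints.
Variables (k : fieldType) (X : variety k).
Local Notation K := (function_field X).
Local Notation gen := (alg_gen (scalar X)).
Hypotheses (properX : is_proper X) (smoothX : is_smooth X) (curveX : dimension_one X).
Implicit Types (x y : pt X) (f z D : K).

Let CP := curve_places smoothX curveX properX.

Lemma rational_value x z : rational_points X x -> z \in subring_pred (stalk x) ->
  exists c, z - scalar X c \in nonunit (stalk x).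
Proof.
move=> xr zx; have [c Ec] := xr (value x z); exists c.
by apply/value_eqP => //; exact: scalar_stalk.
Qed.

(** A uniformizer at a point that properly specializes another one will do. Its stalk is not all of
    [K], since separatedness for the trivial valuation allows only one point with stalk [K]. *)
Lemma exists_nonconstant : exists f : K, forall c, f != scalar X c.
Proof.
case: curveX => [[x [y [xy yx]]] _].
have [p pU] : exists p, uniformizer (stalk y) p.
  case: (stalk_cases smoothX curveX y) => // yK; case: yx.
  have xK z : z \in subring_pred (stalk x) by exact: xy.
  have eqxy : subring_pred (stalk y) =i subring_pred (stalk x) by move=> z; rewrite yK xK.
  apply: (@variety_separated _ X (stalk x)).
  - by move=> z; left.
  - by move=> t; exact: xK.
  - by split=> z; rewrite ?inE !eqxy.
  - by split.
have [pn p0] := uniformizer_nonunit pU; exists p => c; apply: contraNneq p0 => pc.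
by rewrite pc in pn *; rewrite (scalar_nonunit (@scalar_stalk _ X y) pn) rmorph0.
Qed.

Lemma rational_closed x : rational_points X x -> closed_points X x.
Proof.
move=> xr; case: (stalk_cases smoothX curveX x) => [xK|[p]]; last exact: uniformizer_closed.
have [f fc] := exists_nonconstant; have [c] := rational_value xr (xK f).
have fc0 : f - scalar X c != 0 by rewrite subr_eq0.
by move/nonunitP => /(_ fc0)[_]; rewrite xK.
Qed.

(** [v] lists the coordinates of [x] in the affine chart [Spec k[g]]. *)
Definition agrees (g : seq K) (v : seq k) x :=
  forall i, (i < size g)%N -> g`_i - scalar X v`_i \in nonunit (stalk x).

Lemma vanishing_values D (g : seq K) : D != 0 -> exists vs : seq (seq k),
  forall x, rational_points X x -> D \in nonunit (stalk x) ->
    {subset g <= subring_pred (stalk x)} -> exists2 v, v \in vs & agrees g v x.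
Proof.
move=> D0; elim: g => [|h g [vs vsE]]; first by exists [:: [::]] => x _ _ _; exists [::].
have [q [q0 qE]] := values_at_zeros CP h D0; have [rs rsE] := poly_roots_seq q0.
exists [seq r :: v | r <- rs, v <- vs] => x xr Dx gx.
have [|v vin vg] := vsE x xr Dx; first by move=> z zg; apply: gx; rewrite inE zg orbT.
have [c hc] := rational_value xr (gx h (mem_head _ _)).
have cr : c \in rs.
  by apply/rsE/(qE (exist _ x (rational_closed xr))).
exists (c :: v); first exact: allpairs_f.
by move=> [|i] //=; exact: vg.
Qed.

(** Functions with a common value in [k] at [x] and [x'] form a ring, which contains [k[g]] once the
    coordinates agree. A denominator invertible at [x] is then invertible at [x'], so [O_x] is
    contained in [O_x']. *)
Lemma agrees_inj g v P P' x x' : closed_points X x' ->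
  {subset g <= subring_pred (stalk x)} -> {subset g <= subring_pred (stalk x')} ->
  agrees g v x -> agrees g v x' ->
  [set z | z \in subring_pred (stalk x)] = alg_localization (scalar X) g P ->
  [set z | z \in subring_pred (stalk x')] = alg_localization (scalar X) g P' -> x = x'.
Proof.
move=> x'c gx gx' vx vx' Ex Ex'; apply: x'c => z zx.
pose S : {pred K} := [pred a | `[< exists c, a - scalar X c \in nonunit (stalk x) /\
  a - scalar X c \in nonunit (stalk x') >]].
have Sc : subring_closed S.
  split=> [|a b /asboolP[c [ac ac']] /asboolP[d [bd bd']]
    |a b /asboolP[c [ac ac']] /asboolP[d [bd bd']]]; apply/asboolP.
  - by exists 1; rewrite rmorph1 subrr !nonunit0.
  - by exists (c - d); rewrite rmorphB; split; apply: congrD => //; exact: congrN.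
  - by exists (c * d); rewrite rmorphM; split; apply: congrM => //; exact: scalar_stalk.
have genS a : gen g a -> exists c, a - scalar X c \in nonunit (stalk x) /\
    a - scalar X c \in nonunit (stalk x').
  move/(_ (Subring Sc)) => h; apply/asboolP; apply: h => [t|a' /(nthP 0)[i ig <-]].
    by apply/asboolP; exists t; rewrite subrr !nonunit0.
  by apply/asboolP; exists v`_i; split; [exact: vx|exact: vx'].
have [a [b [ga gb bP Ez]]] : alg_localization (scalar X) g P z by rewrite -Ex.
have ax' : a \in subring_pred (stalk x').
  have [c [_ ac]] := genS a ga; apply: congr_sub ac; exact: scalar_stalk.
have [c [bc bc']] := genS b gb.
rewrite Ez; apply: rpredM => //; have [->|b0] := eqVneq b 0; first by rewrite invr0 rpred0.
have bx' : b \in subring_pred (stalk x').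
  apply: congr_sub bc'; exact: scalar_stalk.
apply: nonunitV => //.
apply/negP => /(nonunit_congr bc')/(scalar_nonunit (@scalar_stalk _ X x')) c0.
move: bc; rewrite c0 rmorph0 subr0 => /nonunitP - /(_ b0)[_ /negP]; apply.
have : [set z | z \in subring_pred (stalk x)] b^-1.
  by rewrite Ex; exists 1, b; rewrite mul1r; split=> //; exact: alg_gen1.
by [].
Qed.

(** There are finitely many charts. In each of them the zeros of [D] have finitely many coordinate
    vectors, and each vector belongs to at most one rational point. *)
Lemma vanishing_finite D : D != 0 ->
  finite_set [set x | rational_points X x /\ D \in nonunit (stalk x)].
Proof.
move=> D0; have [charts [_ cover _]] := variety_charts X.
have /choice[vs vsE] : forall g : seq K, exists vs : seq (seq k),
    forall x, rational_points X x -> D \in nonunit (stalk x) ->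
    {subset g <= subring_pred (stalk x)} -> exists2 v, v \in vs & agrees g v x.
  by move=> g; exact: vanishing_values.
pose T g v := [set x | [/\ rational_points X x, {subset g <= subring_pred (stalk x)}, agrees g v x &
  exists P, [set z | z \in subring_pred (stalk x)] = alg_localization (scalar X) g P]].
have Tfin g v : finite_set (T g v).
  have [[x xT]|nT] := pselect (exists x, T g v x); last first.
    by rewrite (_ : T g v = set0) //; apply/seteqP; split=> // x xT; case: nT; exists x.
  apply: (@sub_finite_set _ _ [set x]); last exact: finite_set1.
  move=> y [yr gy vy [P' Ey]]; case: xT => xr gx vx [P Ex].
  exact: (agrees_inj (rational_closed xr) gy gx vy vx Ey Ex).
apply: (@sub_finite_set _ _ (\bigcup_(g in [set` charts]) \bigcup_(v in [set` vs g]) T g v)).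
  move=> x [xr Dx]; have [g [P [gc gP Ex]]] := cover x.
  have gx : {subset g <= subring_pred (stalk x)}.
    move=> z zg; have : alg_localization (scalar X) g P z.
      by apply: (gen_localization gP) => A _; apply.
    by rewrite -Ex.
  have [v vin vx] := vsE g x xr Dx gx.
  by exists g => //; exists v => //; split=> //; exists P.
apply: bigcup_finite => [|g _]; first exact: finite_seq.
by apply: bigcup_finite => //; exact: finite_seq.
Qed.

Variable E : set (pt X).
Hypotheses (Efin : finite_set E) (Ecl : E `<=` closed_points X).
Hypothesis ratX : infinite_set (rational_points X).

Lemma generic_point (ds : seq K) : 0 \notin ds -> exists x,
  [/\ rational_points X x, closed_points X x, ~ E x &
      forall d, d \in ds -> d \in subring_pred (stalk x) /\ d \notin nonunit (stalk x)].
Proof.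
move=> ds0; apply: contrapT => none; apply: ratX.
pose V D := [set x | rational_points X x /\ D \in nonunit (stalk x)].
apply: (@sub_finite_set _ _ (E `|` \bigcup_(d in [set` ds]) (V d `|` V d^-1))); last first.
  rewrite finite_setU; split=> //; apply: bigcup_finite => [|d /= dds]; first exact: finite_seq.
  have d0 : d != 0 by apply: contraNneq ds0 => <-.
  by rewrite finite_setU; split; apply: vanishing_finite; rewrite ?invr_eq0.
move=> x xr; apply: contrapT => /not_orP[xE xV]; apply: none; exists x; split=> //.
  exact: rational_closed.
move=> d dds; have dn : d \notin nonunit (stalk x).
  by apply/negP => dx; apply: xV; exists d => //; left.
split=> //; apply: contraT => dx; case: xV; exists d => //; right; split=> //.
have [p pU] := closed_uniformizer smoothX curveX (rational_closed xr).
exact: (valuation_nonunitV (uniformizer_valuation pU)).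
Qed.

(** A nonconstant function has, at a generic rational point, a value outside [s]. *)
Lemma field_infinite (s : seq k) : exists c, c \notin s.
Proof.
have [f fc] := exists_nonconstant.
have [|x [xr _ _ xds]] := @generic_point (f :: [seq f - scalar X c | c <- s]).
  rewrite inE negb_or eq_sym -(rmorph0 (scalar X)) fc /=.
  by apply/mapP => -[c _ /esym/eqP]; rewrite rmorph0 subr_eq0 (negPf (fc c)).
have [fx _] := xds f (mem_head _ _); have [c hc] := rational_value xr fx; exists c.
apply/negP => cs; have [|_] := xds (f - scalar X c); last by rewrite hc.
by rewrite inE; apply/orP; right; exact: (map_f (fun c => f - scalar X c)).
Qed.

Lemma avoid_values (zs : seq K) (s : seq k) : exists2 c, c \notin s &
  forall e z, E e -> z \in zs -> z - scalar X c \notin nonunit (stalk e).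
Proof.
pose bad := \bigcup_(e in E) \bigcup_(z in [set` zs])
  [set c | z - scalar X c \in nonunit (stalk e)].
have /finite_seqP[bs bsE] : finite_set bad.
  apply: bigcup_finite => // e _; apply: bigcup_finite => [|z _]; first exact: finite_seq.
  have [[c hc]|nc] := pselect (exists c, z - scalar X c \in nonunit (stalk e)); last first.
    rewrite (_ : [set c | _] = set0) //.
    by apply/seteqP; split=> // c hc; case: nc; exists c.
  apply: (@sub_finite_set _ _ [set c]); last exact: finite_set1.
  move=> d /= hd; apply: (scalar_congr (@scalar_stalk _ X e)).
  by apply: congr_trans (congr_sym hd) _.
have [c] := field_infinite (s ++ bs); rewrite mem_cat negb_or => /andP[cs cb].
exists c => // e z Ee zz; apply: contra cb => hc.
have : bad c by exists e => //; exists z.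
by rewrite bsE.
Qed.

Lemma semilocalP f : semilocal_units E f <-> f != 0 /\
  forall e, E e -> f \in subring_pred (stalk e) /\ f \notin nonunit (stalk e).
Proof.
split=> -[f0 h]; split=> // e Ee; have [hn hs _] := ord_sign smoothX curveX (Ecl Ee) f0.
  by rewrite hs hn h.
have [] := h e Ee; rewrite hs hn -leNgt => h1 h2.
by apply/eqP; rewrite eq_le h1 h2.
Qed.

Lemma semilocal_scalar c : c != 0 -> semilocal_units E (scalar X c).
Proof.
move=> c0; apply/semilocalP; split=> [|e _]; first by rewrite fmorph_eq0.
by split; [exact: scalar_stalk|apply: scalar_unit => // t; exact: scalar_stalk].
Qed.

Lemma semilocalM f g : semilocal_units E f -> semilocal_units E g -> semilocal_units E (f * g).
Proof.
move=> /semilocalP[f0 hf] /semilocalP[g0 hg]; apply/semilocalP.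
split=> [|e Ee]; first exact: mulf_neq0.
have [f1 f2] := hf e Ee; have [g1 g2] := hg e Ee; split; first exact: rpredM.
by apply/negP => /(nonunit_mul f1 g1)[]; exact/negP.
Qed.

Lemma semilocalV f : semilocal_units E f -> semilocal_units E f^-1.
Proof.
move=> /semilocalP[f0 hf]; apply/semilocalP; rewrite invr_eq0; split=> // e /hf[f1 f2].
split; first exact: nonunitV.
by apply/negP => /nonunitP; rewrite invrK invr_eq0 f1 => /(_ f0)[].
Qed.

Lemma semilocal_translate z : (forall e, E e -> z \in subring_pred (stalk e)) ->
  forall ts : seq k, exists c, [/\ c != 0,
    (forall t, t \in ts -> semilocal_units E (z - scalar X (c + t))) &
    semilocal_units E (z - scalar X c)].
Proof.
move=> zE ts.
have [s sE] : exists s : seq k, forall c, z = scalar X c -> c \in s.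
  have [[c hc]|nc] := pselect (exists c, z = scalar X c); last first.
    by exists [::] => c hc; case: nc; exists c.
  by exists [:: c] => d; rewrite hc inE => /fmorph_inj->.
(* Avoiding the values of [zs] on [E] makes the translates units there; avoiding [ss] keeps [c] and
   the translates nonzero when [z] is a constant. *)
pose zs := z :: [seq z - scalar X t | t <- ts].
pose ss := 0 :: s ++ [seq c - t | t <- ts, c <- s].
have [c cs cE] := avoid_values zs ss.
move: cs; rewrite inE mem_cat !negb_or => /and3P[c0 cs cts].
exists c; split=> // [t tts|]; apply/semilocalP.
  have hE : z - scalar X (c + t) = z - scalar X t - scalar X c by rewrite rmorphD; ring.
  split=> [|e Ee].
    rewrite subr_eq0; apply: contra cts => /eqP/sE cst.
    by rewrite -[c](addrK t); exact: (allpairs_f (fun t c => c - t)).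
  split; first by rewrite rpredB ?zE ?scalar_stalk.
  rewrite hE; apply: cE => //.
  by rewrite inE; apply/orP; right; exact: (map_f (fun t => z - scalar X t)).
split=> [|e Ee]; first by rewrite subr_eq0; apply: contra cs => /eqP/sE.
by split; [rewrite rpredB ?zE ?scalar_stalk|rewrite cE // mem_head].
Qed.

(* Every [z] is obtained from a unit by the operations of the field. *)
Lemma semilocal_generates z : exists c d, [/\ z - scalar X c != 0, d != 0 &
  semilocal_units E ((z - scalar X c)^-1 - scalar X d)].
Proof.
have [s sE] : exists s : seq k, forall c, z = scalar X c -> c \in s.
  have [[c hc]|nc] := pselect (exists c, z = scalar X c); last first.
    by exists [::] => c hc; case: nc; exists c.
  by exists [:: c] => d; rewrite hc inE => /fmorph_inj->.
have [c cs cE] := avoid_values [:: z] s.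
have [|d [d0 _ hd]] := @semilocal_translate (z - scalar X c)^-1 _ [::].
  move=> e Ee; have zc := cE e z Ee (mem_head _ _).
  have [p pU] := closed_uniformizer smoothX curveX (Ecl Ee).
  case: (uniformizer_valuation pU (z - scalar X c)) => // zce; exact: nonunitV.
exists c, d; split=> //.
by rewrite subr_eq0; apply: contra cs => /eqP/sE.
Qed.

End RationalPoints.

(** * The field of constants *)

Record subfield (K : fieldType) := Subfield {
  subfield_pred :> {pred K};
  subfieldP : divring_closed subfield_pred }.

HB.instance Definition _ (K : fieldType) (A : subfield K) :=
  GRing.isDivringClosed.Build K (subfield_pred A) (subfieldP A).

Record subfield_type (K : fieldType) (A : subfield K) := SubfieldElt {
  subfield_val : K;
  subfield_valP : subfield_val \in subfield_pred A }.

Section SubfieldType.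
Variables (K : fieldType) (A : subfield K).
HB.instance Definition _ := [isSub for @subfield_val K A].
HB.instance Definition _ := [Choice of subfield_type A by <:].
HB.instance Definition _ := [SubChoice_isSubComUnitRing of subfield_type A by <:].
HB.instance Definition _ := [SubComUnitRing_isSubIntegralDomain of subfield_type A by <:].
HB.instance Definition _ := [SubIntegralDomain_isSubField of subfield_type A by <:].
End SubfieldType.

(** The global functions form a field by [global_inv]. With them as scalars the places remain
    complete, and every function without poles becomes a scalar. *)
Lemma constant_field (k K : fieldType) (j : {rmorphism k -> K}) (P : Type)
    (O : P -> local_subring K) : complete_places j O ->
  exists (L : fieldType) (i : {rmorphism L -> K}), complete_places i O /\
    forall z, (forall y, z \in subring_pred (O y)) -> exists c, z = i c.
Proof.
move=> CP; pose S : {pred K} := [pred z | `[< forall y, z \in subring_pred (O y) >]].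
have Sc : divring_closed S.
  split=> [|a b /asboolP ha /asboolP hb|a b /asboolP ha /asboolP hb]; apply/asboolP => y.
  - exact: rpred1.
  - by apply: rpredB; [exact: ha|exact: hb].
  - by apply: rpredM; [exact: ha|exact: (global_inv CP hb y)].
exists (subfield_type (Subfield Sc)), val; split; last first.
  by move=> z /asboolP zS; exists (SubfieldElt (A := Subfield Sc) zS).
have valO y (c : subfield_type (Subfield Sc)) : val c \in subring_pred (O y).
  by have /asboolP := subfield_valP c.
split=> //; first exact: places_valuation CP.
  exact: places_rank_one CP.
move=> A p cA; apply: (places_centre CP) => c.
have cS : j c \in Subfield Sc by apply/asboolP => y; exact: places_scalar CP _ _.
exact: (cA (SubfieldElt cS)).
Qed.

Lemma value0 (k : fieldType) (X : variety k) (x : pt X) : value x 0 = 0.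
Proof.
rewrite /value (_ : insubd 0 0 = 0); last by apply: val_inj; rewrite insubdK // rpred0.
exact: rmorph0.
Qed.

Lemma preimage_seq (T U : eqType) (h : T -> U) (s : seq U) : injective h ->
  exists r : seq T, forall t, h t \in s -> t \in r.
Proof.
move=> hI; elim: s => [|u s [r rE]]; first by exists [::].
have [[t0 ht0]|nt] := pselect (exists t, h t = u); last first.
  by exists r => t; rewrite inE => /predU1P[ht|/rE//]; case: nt; exists t.
exists (t0 :: r) => t; rewrite inE => /predU1P[|/rE tr]; last by rewrite inE tr orbT.
by rewrite -ht0 => /hI->; exact: mem_head.
Qed.

(** * Extension of the embedding of unit groups *)

Section Reconstruction.
Variables (kX kY : fieldType) (X : variety kX) (Y : variety kY).
Local Notation KX := (function_field X).
Local Notation KY := (function_field Y).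
Hypotheses (properX : is_proper X) (smoothX : is_smooth X) (curveX : dimension_one X).
Hypotheses (smoothY : is_smooth Y) (curveY : dimension_one Y).
Variables (EX : set (pt X)) (EY : set (pt Y)).
Hypotheses (EXcl : EX `<=` closed_points X) (EYcl : EY `<=` closed_points Y).
Hypotheses (EXfin : finite_set EX) (EYfin : finite_set EY).
Variable phi : pt X -> pt Y.
Hypothesis phi_bij : set_bij (closed_points X `\` EX) (closed_points Y `\` EY) phi.
Variable iota : KX -> KY.
Hypothesis iota_units : forall f, semilocal_units EX f -> semilocal_units EY (iota f).
Hypothesis iotaM : forall f g, semilocal_units EX f -> semilocal_units EX g ->
  iota (f * g) = iota f * iota g.
Hypothesis iota_inj : forall f g, semilocal_units EX f -> semilocal_units EX g ->
  iota f = iota g -> f = g.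
Hypothesis iota_ord : order_preserving EX phi iota.
Hypothesis iota_val : value_preserving EX phi iota.
Hypothesis ratX : infinite_set (rational_points X).

Local Notation OY := (fun y : {y | closed_points Y y} => stalk (sval y)).
Variables (L : fieldType) (j : {rmorphism L -> KY}).
Hypothesis CP : complete_places j OY.
Hypothesis constants : forall z, (forall y, z \in subring_pred (OY y)) -> exists c, z = j c.

Local Notation UX := (semilocal_units EX).
Implicit Types (x : pt X) (y : pt Y) (f g z : KX) (w : KY) (a b c s t : kX).

Let X' x := closed_points X x /\ ~ EX x.

Let UP := semilocalP smoothX curveX EXcl.
Let UPY := semilocalP smoothY curveY EYcl.

Lemma phi_closed x : X' x -> closed_points Y (phi x) /\ ~ EY (phi x).
Proof. by case: phi_bij => h _ _ /h. Qed.

Lemma jO y (c : L) : closed_points Y y -> j c \in subring_pred (stalk y).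
Proof. by move=> yc; exact: (places_scalar CP (exist _ y yc)). Qed.

Lemma closed_cases y : closed_points Y y -> EY y \/ exists2 x, X' x & y = phi x.
Proof.
move=> yc; have [|yE] := pselect (EY y); [by left|right].
by case: phi_bij => _ _ /(_ y (conj yc yE))[x xX <-]; exists x.
Qed.

Lemma iota_neq0 f : UX f -> iota f != 0.
Proof. by move/iota_units => []. Qed.

Lemma iota_ord_sign x f : X' x -> UX f ->
  (iota f \in nonunit (stalk (phi x))) = (f \in nonunit (stalk x)) /\
  (iota f \in subring_pred (stalk (phi x))) = (f \in subring_pred (stalk x)).
Proof.
move=> xX fU; have [yc _] := phi_closed xX; have [e [e0 eE]] := iota_ord xX.
have [-> -> _] := ord_sign smoothY curveY yc (iota_neq0 fU).
have [-> -> _] := ord_sign smoothX curveX xX.1 fU.1.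
by rewrite eE // pmulr_rgt0 ?pmulr_rge0.
Qed.

(** The value of [g] at [x] is nonzero, so [iota_x] applies: being a function it gives one
    direction, and its injectivity gives the other. *)
Lemma iota_congr x f g : X' x -> UX f -> UX g ->
  g \in subring_pred (stalk x) -> g \notin nonunit (stalk x) ->
  f - g \in nonunit (stalk x) <-> iota f - iota g \in nonunit (stalk (phi x)).
Proof.
move=> xX fU gU gx gn; have [yc _] := phi_closed xX.
have ord0 h : UX h -> h \in subring_pred (stalk x) -> h \notin nonunit (stalk x) -> ord x h = 0.
  move=> [h0 _]; have [-> -> _] := ord_sign smoothX curveX xX.1 h0.
  by rewrite -leNgt => h1 h2; apply/eqP; rewrite eq_le h1 h2.
have [ix [ix0 _ ixI ixE]] := iota_val xX.
have [fN fS] := iota_ord_sign xX fU; have [gN gS] := iota_ord_sign xX gU.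
have vn0 h : h \in subring_pred (stalk x) -> h \notin nonunit (stalk x) -> value x h != 0.
  move=> hx hn; apply: contraNneq hn; rewrite -(value0 x) => /(value_eqP hx (rpred0 _)).
  by rewrite subr0.
have [_ gE] := ixE g gU (ord0 g gU gx gn).
split=> fg.
  have fx := congr_sub gx fg.
  have fn : f \notin nonunit (stalk x) by apply: contra gn => /(nonunit_congr fg).
  have [_ fE] := ixE f fU (ord0 f fU fx fn).
  by apply/value_eqP; rewrite ?fS ?gS // -fE -gE; congr (ix _); apply/value_eqP.
have gy : iota g \in subring_pred (stalk (phi x)) by rewrite gS.
have fy := congr_sub gy fg; have fx : f \in subring_pred (stalk x) by rewrite -fS.
have fn : f \notin nonunit (stalk x).
  by apply: contra gn; rewrite -fN -gN => /(nonunit_congr fg).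
have [_ fE] := ixE f fU (ord0 f fU fx fn).
apply/value_eqP => //; apply: ixI; [exact: vn0|exact: vn0|].
by rewrite fE gE; apply/value_eqP.
Qed.

Lemma iota1 : iota 1 = 1.
Proof.
have U1 : UX 1 by rewrite -(rmorph1 (scalar X)); apply: semilocal_scalar => //; exact: oner_neq0.
by apply: (mulfI (iota_neq0 U1)); rewrite -iotaM // !mulr1.
Qed.

Let Uscalar c : c != 0 -> UX (scalar X c).
Proof. exact: semilocal_scalar. Qed.

(** The image of a nonzero constant has no pole: on [EY] it is a unit, and elsewhere order
    preservation applies. Hence it is a constant of [Y]. *)
Lemma scalar_image : exists psi : kX -> L, psi 0 = 0 /\
  forall c, c != 0 -> j (psi c) = iota (scalar X c).
Proof.
have /choice[psi psiE] : forall c, exists d, (c = 0 -> d = 0) /\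
    (c != 0 -> j d = iota (scalar X c)).
  move=> c; have [->|c0] := eqVneq c 0; first by exists 0.
  have cU := Uscalar c0.
  have [|d Ed] := @constants (iota (scalar X c)); last first.
    by exists d; split=> // c00; rewrite c00 eqxx in c0.
  move=> [y yc] /=; have [yE|[x xX ->]] := closed_cases yc.
    by have /UPY[_ /(_ y yE)[]] := iota_units cU.
  by have [_ ->] := iota_ord_sign xX cU; exact: scalar_stalk.
by exists psi; split=> [|c]; [exact: (psiE 0).1|exact: (psiE c).2].
Qed.

(** * The induced map on constants *)

Section Psi.
Variable psi : kX -> L.
Hypothesis psi0 : psi 0 = 0.
Hypothesis psiE : forall c, c != 0 -> j (psi c) = iota (scalar X c).

Lemma psi_neq0 c : c != 0 -> psi c != 0.
Proof. by move=> c0; rewrite -(fmorph_eq0 j) psiE // iota_neq0 //; exact: Uscalar. Qed.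

Lemma psi_inj : injective psi.
Proof.
move=> a b; have [->|a0] := eqVneq a 0; have [->|b0] := eqVneq b 0 => //.
- by rewrite psi0 => /esym/eqP; rewrite (negPf (psi_neq0 b0)).
- by rewrite psi0 => /eqP; rewrite (negPf (psi_neq0 a0)).
move/(congr1 j); rewrite !psiE // => /iota_inj h.
by apply: (fmorph_inj (scalar X)); apply: h; exact: Uscalar.
Qed.

Lemma iota_value x f c : X' x -> UX f -> c != 0 ->
  f - scalar X c \in nonunit (stalk x) <-> iota f - j (psi c) \in nonunit (stalk (phi x)).
Proof.
move=> xX fU c0; rewrite psiE //; apply: iota_congr => //.
- exact: Uscalar.
- exact: scalar_stalk.
- by apply: scalar_unit => // t; exact: scalar_stalk.
Qed.

Lemma generic_value f : UX f -> forall ds : seq KX, 0 \notin ds -> exists x c,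
  [/\ X' x /\ rational_points X x, c != 0, f - scalar X c \in nonunit (stalk x),
      iota f - j (psi c) \in nonunit (stalk (phi x)) &
      forall d, d \in ds -> d \in subring_pred (stalk x) /\ d \notin nonunit (stalk x)].
Proof.
move=> fU ds ds0.
have [|x [xr xc xE xds]] := @generic_point _ _ properX smoothX curveX _ EXfin ratX (f :: ds).
  by rewrite inE negb_or eq_sym fU.1.
have [fx fn] := xds f (mem_head _ _); have [c fc] := rational_value xr fx.
have c0 : c != 0 by apply: contraNneq fn => c0; rewrite -[f]subr0 -(rmorph0 (scalar X)) -c0.
exists x, c; split=> //; first exact/(iota_value _ fU c0).
by move=> d dds; apply: xds; rewrite inE dds orbT.
Qed.

(** [f] takes two distinct values at rational points, and [psi] keeps them distinct. *)
Lemma iota_nonconstant f : UX f -> (forall c, f != scalar X c) -> forall d, iota f != j d.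
Proof.
move=> fU fc d; apply/eqP => fd.
have [x1 [c1 [[X1 _] _ _ y1 _]]] := @generic_value f fU [::] isT.
have [|x2 [c2 [[X2 _] _ f2 y2 ds2]]] := @generic_value f fU [:: f - scalar X c1].
  by rewrite inE eq_sym subr_eq0.
have [yc1 _] := phi_closed X1; have [yc2 _] := phi_closed X2.
have E1 : d = psi c1 by apply: (scalar_congr (fun c : L => jO c yc1)); rewrite -fd.
have E2 : d = psi c2 by apply: (scalar_congr (fun c : L => jO c yc2)); rewrite -fd.
have cc : c1 = c2 by apply: psi_inj; rewrite -E1.
by have [_] := ds2 _ (mem_head _ _); rewrite cc f2.
Qed.

(** * Compatibility with translation by a constant *)

Section Translate.
Variables (f : KX) (a : kX).
Hypotheses (fU : UX f) (faU : UX (f - scalar X a)) (a0 : a != 0).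
Hypothesis Fc : forall d, iota f != j d.
Local Notation F := (iota f).
Local Notation G := (iota (f - scalar X a)).
Local Notation T := (F - j (psi a)).

Let T0 : T != 0. Proof. by rewrite subr_eq0. Qed.

(** A pole of [F] comes from a pole of [f], where [(f - a) / f] has value 1. Preservation of values
    gives [G / F] the value 1, and [F / T] has value 1 as well. *)
Lemma translate_pole y : closed_points Y y -> F \notin subring_pred (stalk y) ->
  G / T - 1 \in nonunit (stalk y).
Proof.
move=> yc Fy; have [yE|[x xX yx]] := closed_cases yc.
  by have /UPY[_ /(_ y yE)[]] := iota_units fU; rewrite (negPf Fy).
have F0 := iota_neq0 fU.
have yval : is_valuation_ring (stalk y) := places_valuation CP (exist _ y yc).
have FV := valuation_nonunitV yval Fy.
have TV : T^-1 \in nonunit (stalk y).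
  apply: valuation_nonunitV => //; apply: contra Fy => Ty.
  by rewrite -[F](subrK (j (psi a))) rpredD // jO.
have -> : G / T - 1 = G / F * (F / T) - 1 * 1 by rewrite mulr1; field; rewrite F0 T0.
apply: congrM; rewrite ?rpred1 //; last first.
  have -> : F / T - 1 = j (psi a) / T by field.
  by apply: nonunitMl => //; exact: jO.
have hU : UX ((f - scalar X a) / f) by apply: semilocalM => //; exact: semilocalV.
have <- : iota ((f - scalar X a) / f) = G / F.
  by apply: (mulIf F0); rewrite -iotaM // !divfK // fU.1.
have U1 : UX 1 by rewrite -(rmorph1 (scalar X)); exact: Uscalar (oner_neq0 _).
have fx : f \notin subring_pred (stalk x).
  by have [_ <-] := iota_ord_sign xX fU; rewrite -yx.
have xval : is_valuation_ring (stalk x).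
  by have [p /uniformizer_valuation] := closed_uniformizer smoothX curveX xX.1.
rewrite -[X in _ - X]iota1 yx; apply/(iota_congr xX hU U1); rewrite ?rpred1 ?nonunit1 //.
have -> : (f - scalar X a) / f - 1 = - scalar X a * f^-1.
  by rewrite mulrBl divff ?fU.1 // addrAC subrr sub0r mulNr.
apply: nonunitMl; first by rewrite rpredN scalar_stalk.
exact: valuation_nonunitV.
Qed.

Lemma translate_unit y : closed_points Y y ->
  G / T \in subring_pred (stalk y) /\ G / T \notin nonunit (stalk y) \/ T \in nonunit (stalk y).
Proof.
move=> yc; have [Fy|Fy] := boolP (F \in subring_pred (stalk y)); last first.
  have h := translate_pole yc Fy; left; split; first exact: congr_sub (rpred1 _) h.
  by apply/negP => /(nonunit_congr h); exact/negP/nonunit1.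
have [Ty|Tn] := boolP (T \in nonunit (stalk y)); [by right|left].
have TVy : T^-1 \in subring_pred (stalk y).
  by apply: nonunitV => //; rewrite rpredB // jO.
suff [Gy Gn] : G \in subring_pred (stalk y) /\ G \notin nonunit (stalk y).
  split; first exact: rpredM.
  apply: contra Gn => /nonunitMr h; rewrite -[G](divfK T0); apply: h.
  by rewrite rpredB // jO.
have [yE|[x xX yx]] := closed_cases yc.
  by have /UPY[_ /(_ y yE)] := iota_units faU.
have [GN GS] := iota_ord_sign xX faU; have [FN FS] := iota_ord_sign xX fU.
rewrite yx GN GS rpredB ?scalar_stalk //; last by rewrite -FS -yx.
by split=> //; apply: contra Tn => /(iota_value xX fU a0); rewrite yx.
Qed.

(** Since the fibre avoids [EY], each of its points is some [phi x] with [f(x) = b]. There [G] has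
    value [psi (b - a)] and [T] has value [psi b - psi a]. *)
Lemma translate_fibre b : b != 0 -> b != a ->
  (forall y, EY y -> F - j (psi b) \notin nonunit (stalk y)) ->
  forall y, closed_points Y y -> F - j (psi b) \in nonunit (stalk y) ->
    G / T - j (psi (b - a) / (psi b - psi a)) \in nonunit (stalk y).
Proof.
move=> b0 ba bE y yc Fb; have [yE|[x xX yx]] := closed_cases yc.
  by case/negP: (bE y yE).
have ba0 : b - a != 0 by rewrite subr_eq0.
have pab : psi b - psi a != 0.
  by rewrite subr_eq0; apply: contra_neq ba; exact: psi_inj.
have Gb : G - j (psi (b - a)) \in nonunit (stalk y).
  rewrite yx; apply/(iota_value xX faU ba0).
  rewrite rmorphB opprB addrA subrK.
  by apply/(iota_value xX fU b0); rewrite -yx.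
rewrite fmorph_div; apply: congrM => //; first exact: jO.
  by rewrite -fmorphV jO.
apply: congrV; first exact: jO.
  by apply: scalar_unit => // c; exact: jO.
by rewrite rmorphB; apply: congrD => //; rewrite subrr nonunit0.
Qed.

Lemma iota_translate : G = F - j (psi a).
Proof.
pose B (c : L) := exists b, [/\ b != 0, b != a, c = psi b &
  forall y, EY y -> F - j (psi b) \notin nonunit (stalk y)].
suff h : G / T = 1 by rewrite -[G](divfK T0) h mul1r.
apply: (@fibre_constant_eq1 _ _ _ _ _ CP constants F _ B _ _ _ (psi a)).
- exact: (nonconstant_transcendental CP constants Fc).
(* Besides 0, [a] and the preimages of the roots of [q], only the finitely many [b] for which [F]
   has value [psi b] on [EY] are excluded. *)
- move=> q q0; have [rs rsE] := poly_roots_seq q0.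
  have [ps psE] := preimage_seq rs psi_inj.
  pose bad := \bigcup_(y in EY) [set b | F - j (psi b) \in nonunit (stalk y)].
  have /finite_seqP[bs bsE] : finite_set bad.
    apply: bigcup_finite => // y yE; set S := [set b | _].
    have [[b Sb]|nS] := pselect (exists b, S b); last first.
      by rewrite (_ : S = set0) //; apply/seteqP; split=> // b Sb; case: nS; exists b.
    apply: (@sub_finite_set _ _ [set b]); last exact: finite_set1.
    move=> d Sd /=; apply: psi_inj.
    apply: (scalar_congr (fun c : L => jO c (EYcl yE))).
    exact: congr_trans (congr_sym Sd) Sb.
  have [b] := field_infinite properX smoothX curveX EXfin ratX (0 :: a :: ps ++ bs).
  rewrite !inE mem_cat !negb_or => /and4P[b0 ba bps bbs].
  exists (psi b); split.
    exists b; split=> // y yE; apply: contra bbs => Fb.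
    have : bad b by exists y.
    by rewrite bsE.
  by apply: contra bps => /eqP/rsE/psE.
- move=> c [b [b0 ba -> bE]]; exists (psi (b - a) / (psi b - psi a)) => -[y yc] /=.
  exact: translate_fibre.
- by rewrite mulf_neq0 ?invr_eq0 // iota_neq0.
- by move=> [y yc] /=; exact: translate_unit.
- by move=> [y yc] /=; exact: translate_pole.
Qed.

End Translate.

Lemma exists_nonconstant_unit : exists2 u, UX u & forall c, u != scalar X c.
Proof.
have [f fc] := exists_nonconstant smoothX curveX.
have [c [d [fc0 d0 uU]]] := semilocal_generates properX smoothX curveX EXfin EXcl ratX f.
exists ((f - scalar X c)^-1 - scalar X d) => // e; apply/eqP => ue.
have /eqP : f = scalar X ((e + d)^-1 + c).
  by rewrite rmorphD fmorphV rmorphD -ue subrK invrK subrK.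
by rewrite (negPf (fc _)).
Qed.

(** A unit [f] is chosen whose translates by [s] and by [s + t] are units too; translating it by
    [s + t] at once or in two steps gives the same function. *)
Lemma psiD : {morph psi : s t / s + t}.
Proof.
have psiD_generic s t : s != 0 -> t != 0 -> s + t != 0 -> psi (s + t) = psi s + psi t.
  move=> s0 t0 st0; have [u uU uc] := exists_nonconstant_unit.
  have uE e : EX e -> u \in subring_pred (stalk e) by move=> eE; have /UP[_ /(_ e eE)[]] := uU.
  have [c [_ cts cU]] :=
    semilocal_translate properX smoothX curveX EXfin EXcl ratX uE [:: s; s + t].
  have := cts s; rewrite mem_head => /(_ isT); rewrite rmorphD opprD addrA => sU.
  have := cts (s + t); rewrite !inE eqxx orbT => /(_ isT); rewrite rmorphD opprD addrA => stU.
  set f := u - scalar X c in sU stU cU.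
  have nc b : forall d, u - scalar X b != scalar X d.
    by move=> d; rewrite subr_eq -rmorphD uc.
  have fF := iota_nonconstant cU (nc c).
  have fsF : forall d, iota (f - scalar X s) != j d.
    by apply: iota_nonconstant => // d; rewrite /f -addrA -opprD -rmorphD nc.
  have E1 := iota_translate cU sU s0 fF.
  have E2 := iota_translate cU stU st0 fF.
  have fst : f - scalar X s - scalar X t = f - scalar X (s + t).
    by rewrite rmorphD opprD addrA.
  have E3 : iota (f - scalar X s - scalar X t) = iota (f - scalar X s) - j (psi t).
    by apply: iota_translate; rewrite ?fst.
  apply: (fmorph_inj j); rewrite rmorphD; apply: (@addrI _ (- iota f)).
  rewrite fst E2 E1 in E3.
  by rewrite -[LHS]opprK opprD opprK E3; ring.
move=> s t; have [->|s0] := eqVneq s 0; first by rewrite psi0 !add0r.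
have [->|t0] := eqVneq t 0; first by rewrite psi0 !addr0.
have [st0|] := eqVneq (s + t) 0; last exact: psiD_generic.
(* When [s + t = 0], an auxiliary [r] with [r] and [r + s] nonzero reduces to the generic case
   through [(r + s) + t = r]. *)
have [r] := field_infinite properX smoothX curveX EXfin ratX [:: 0; - s].
rewrite !inE !negb_or => /andP[r0 rs].
have rs0 : r + s != 0 by rewrite addr_eq0.
have Er : r + s + t = r by rewrite -addrA st0 addr0.
have := psiD_generic (r + s) t rs0 t0; rewrite Er psiD_generic // => /(_ r0) E.
rewrite st0 psi0; apply: (@addrI _ (psi r)); by rewrite addr0 addrA.
Qed.

Lemma psi1 : psi 1 = 1.
Proof.
by apply: (fmorph_inj j); rewrite psiE ?oner_neq0 // !rmorph1 iota1.
Qed.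

Lemma psiM : {morph psi : s t / s * t}.
Proof.
move=> s t; have [->|s0] := eqVneq s 0; first by rewrite mul0r psi0 mul0r.
have [->|t0] := eqVneq t 0; first by rewrite mulr0 psi0 mulr0.
apply: (fmorph_inj j); rewrite rmorphM !psiE ?mulf_neq0 // rmorphM iotaM //; exact: Uscalar.
Qed.

Lemma psiB : {morph psi : s t / s - t}.
Proof. by move=> s t; apply: (@addIr _ (psi t)); rewrite -psiD !subrK. Qed.

Lemma psiV c : c != 0 -> psi c^-1 = (psi c)^-1.
Proof.
by move=> c0; apply: (mulfI (psi_neq0 c0)); rewrite -psiM !mulfV ?psi1 // psi_neq0.
Qed.

(** The graph of the extension. Almost all points are those off the zeros and poles of a finite
    list, so two such conditions combine by concatenation and [generic_point] meets them. *)
Definition corresponds z w := exists2 ds : seq KX, 0 \notin ds &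
  forall x, X' x -> rational_points X x ->
    (forall d, d \in ds -> d \in subring_pred (stalk x) /\ d \notin nonunit (stalk x)) ->
    exists2 c, z - scalar X c \in nonunit (stalk x) & w - j (psi c) \in nonunit (stalk (phi x)).

Lemma corresponds2 z w z' w' z'' w'' : corresponds z w -> corresponds z' w' ->
  (forall x c c', X' x -> z - scalar X c \in nonunit (stalk x) ->
    w - j (psi c) \in nonunit (stalk (phi x)) -> z' - scalar X c' \in nonunit (stalk x) ->
    w' - j (psi c') \in nonunit (stalk (phi x)) ->
    exists2 c'', z'' - scalar X c'' \in nonunit (stalk x) &
      w'' - j (psi c'') \in nonunit (stalk (phi x))) -> corresponds z'' w''.
Proof.
move=> [ds ds0 dsE] [ds' ds'0 ds'E] h; exists (ds ++ ds'); first by rewrite mem_cat negb_or ds0.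
move=> x xX xr xds.
have [d dd|c zc wc] := dsE x xX xr; first by apply: xds; rewrite mem_cat dd.
have [d dd|c' zc' wc'] := ds'E x xX xr; first by apply: xds; rewrite mem_cat dd orbT.
exact: h zc wc zc' wc'.
Qed.

Lemma corresponds_scalar c : corresponds (scalar X c) (j (psi c)).
Proof. by exists [::] => // x _ _ _; exists c; rewrite subrr nonunit0. Qed.

Lemma corresponds1 : corresponds 1 1.
Proof. by have := corresponds_scalar 1; rewrite psi1 !rmorph1. Qed.

Lemma corresponds_iota u : UX u -> corresponds u (iota u).
Proof.
move=> uU; exists [:: u] => [|x xX xr /(_ u (mem_head _ _))[ux un]].
  by rewrite inE eq_sym uU.1.
have [c uc] := rational_value xr ux; exists c => //; apply/iota_value => //.
by apply: contraNneq un => c0; rewrite -[u]subr0 -(rmorph0 (scalar X)) -c0.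
Qed.

Lemma correspondsB z w z' w' : corresponds z w -> corresponds z' w' ->
  corresponds (z - z') (w - w').
Proof.
move=> zw zw'; apply: (corresponds2 zw zw') => x c c' xX zc wc zc' wc'.
by exists (c - c'); rewrite ?psiB rmorphB; apply: congrD => //; exact: congrN.
Qed.

Lemma correspondsD z w z' w' : corresponds z w -> corresponds z' w' ->
  corresponds (z + z') (w + w').
Proof.
move=> zw zw'; apply: (corresponds2 zw zw') => x c c' xX zc wc zc' wc'.
by exists (c + c'); rewrite ?psiD rmorphD; exact: congrD.
Qed.

Lemma correspondsM z w z' w' : corresponds z w -> corresponds z' w' ->
  corresponds (z * z') (w * w').
Proof.
move=> zw zw'; apply: (corresponds2 zw zw') => x c c' xX zc wc zc' wc'.
have [yc _] := phi_closed xX.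
by exists (c * c'); rewrite ?psiM rmorphM; apply: congrM => //;
  first [exact: scalar_stalk|exact: jO].
Qed.

Lemma correspondsV z w : z != 0 -> corresponds z w -> corresponds z^-1 w^-1.
Proof.
move=> z0 [ds ds0 dsE]; exists (z :: ds); first by rewrite inE negb_or eq_sym z0.
move=> x xX xr xds; have [d dd|c zc wc] := dsE x xX xr.
  by apply: xds; rewrite inE dd orbT.
have [_ zn] := xds z (mem_head _ _); have [yc _] := phi_closed xX.
have c0 : c != 0 by apply: contraNneq zn => c0; rewrite -[z]subr0 -(rmorph0 (scalar X)) -c0.
exists c^-1; rewrite ?psiV // fmorphV; apply: congrV => //.
- exact: scalar_stalk.
- by apply: scalar_unit => // t; exact: scalar_stalk.
- exact: jO.
- by apply: scalar_unit => [t|]; [exact: jO|exact: psi_neq0].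
Qed.

(** The points [phi x] where [w - w'] vanishes are counted through the values of [iota u], for a
    nonconstant unit [u]. If [w - w'] were nonzero, these values would be roots of a fixed
    polynomial, and a generic [x] avoids them. *)
Lemma corresponds_unique z w w' : corresponds z w -> corresponds z w' -> w = w'.
Proof.
move=> [ds ds0 dsE] [ds' ds'0 ds'E]; apply/eqP; rewrite -subr_eq0; apply: contraT => D0.
have [u uU uc] := exists_nonconstant_unit.
have [q [q0 qE]] := values_at_zeros CP (iota u) D0.
have [rs rsE] := poly_roots_seq q0; have [ps psE] := preimage_seq rs psi_inj.
have [|x [c [[xX xr] c0 uxc ucy xds]]] :=
    @generic_value u uU (ds ++ ds' ++ [seq u - scalar X e | e <- ps]).
  rewrite !mem_cat !negb_or ds0 ds'0 /=; apply/mapP => -[e _ /esym/eqP].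
  by rewrite subr_eq0 (negPf (uc e)).
have [d dd|e ze we] := dsE x xX xr; first by apply: xds; rewrite mem_cat dd.
have [d dd|e' ze' we'] := ds'E x xX xr; first by apply: xds; rewrite !mem_cat dd orbT.
have [yc _] := phi_closed xX.
have ee : e = e'.
  apply: (scalar_congr (@scalar_stalk _ X x)); exact: congr_trans (congr_sym ze) ze'.
have /rsE/psE cps : q.[psi c] = 0.
  apply: (qE (exist _ _ yc)) => //=; rewrite ee in we.
  exact: congr_trans we (congr_sym we').
have [|_] := xds (u - scalar X c); last by rewrite uxc.
rewrite !mem_cat; apply/orP; right; apply/orP; right.
exact: (map_f (fun e => u - scalar X e)).
Qed.

Lemma corresponds_total z : exists w, corresponds z w.
Proof.
have [c [d [zc0 d0 uU]]] := semilocal_generates properX smoothX curveX EXfin EXcl ratX z.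
set u := _ - _ in uU.
exists ((iota u + j (psi d))^-1 + j (psi c)).
have -> : z = (u + scalar X d)^-1 + scalar X c by rewrite subrK invrK subrK.
apply: correspondsD; last exact: corresponds_scalar.
apply: correspondsV; first by rewrite subrK invr_eq0.
by apply: correspondsD; [exact: corresponds_iota|exact: corresponds_scalar].
Qed.

Lemma extension_exists : exists sigma : {rmorphism KX -> KY},
  forall f, UX f -> sigma f = iota f.
Proof.
have /choice[sigma sE] := corresponds_total.
have sB : zmod_morphism sigma.
  by move=> z z'; apply: (corresponds_unique (sE _)); exact: correspondsB.
have sM : monoid_morphism sigma.
  split; first by apply: (corresponds_unique (sE _)); exact: corresponds1.
  by move=> z z'; apply: (corresponds_unique (sE _)); exact: correspondsM.
pose S : {rmorphism KX -> KY} := HB.pack sigma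
  (GRing.isZmodMorphism.Build _ _ sigma sB) (GRing.isMonoidMorphism.Build _ _ sigma sM).
exists S => f fU; apply: (corresponds_unique (sE _)); exact: corresponds_iota.
Qed.

End Psi.

Lemma extension_unique (sigma tau : {rmorphism KX -> KY}) :
  (forall f, UX f -> tau f = sigma f) -> tau =1 sigma.
Proof.
move=> st z.
have [c [d [zc0 d0 uU]]] := semilocal_generates properX smoothX curveX EXfin EXcl ratX z.
have scE t : tau (scalar X t) = sigma (scalar X t).
  by have [->|t0] := eqVneq t 0; [rewrite !rmorph0|apply/st/Uscalar].
set u := _ - _ in uU.
have -> : z = (u + scalar X d)^-1 + scalar X c by rewrite subrK invrK subrK.
by rewrite [LHS]rmorphD [RHS]rmorphD !fmorphV !(rmorphD _ u) !scE (st u uU).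
Qed.

End Reconstruction.

Theorem proposition4p4 (kX kY : fieldType) (X : variety kX) (Y : variety kY)
    (properX : is_proper X) (properY : is_proper Y)
    (smoothX : is_smooth X) (smoothY : is_smooth Y)
    (connX : geometrically_connected X) (connY : geometrically_connected Y)
    (curveX : dimension_one X) (curveY : dimension_one Y)
    (EX : set (pt X)) (EY : set (pt Y))
    (EXcl : EX `<=` closed_points X) (EYcl : EY `<=` closed_points Y)
    (EXfin : finite_set EX) (EYfin : finite_set EY)
    (phi : pt X -> pt Y)
    (phi_bij : set_bij (closed_points X `\` EX) (closed_points Y `\` EY) phi)
    (iota : function_field X -> function_field Y)
    (iota_units : forall f, semilocal_units EX f -> semilocal_units EY (iota f))
    (iotaM : forall f g, semilocal_units EX f -> semilocal_units EX g ->
       iota (f * g) = iota f * iota g)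
    (iota_inj : forall f g, semilocal_units EX f -> semilocal_units EX g ->
       iota f = iota g -> f = g)
    (iota_ord : order_preserving EX phi iota)
    (iota_val : value_preserving EX phi iota)
    (ratX : infinite_set (rational_points X)) :
  exists sigma : {rmorphism function_field X -> function_field Y},
    (forall f, semilocal_units EX f -> sigma f = iota f) /\
    (forall tau : {rmorphism function_field X -> function_field Y},
       (forall f, semilocal_units EX f -> tau f = iota f) -> tau =1 sigma).
Proof.
(* The scalars of [Y] are replaced by its field of global functions, where the images of constants
   of [X] are seen to lie. *)
have [L [j [CP constants]]] := constant_field (curve_places smoothY curveY properY).
have [psi [psi0 psiE]] := scalar_image smoothX curveX smoothY curveY EXcl EYcl
  phi_bij iota_units iota_ord constants.
have [sigma sigmaE] := extension_exists properX smoothX curveX smoothY curveY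
  EXcl EYcl EXfin EYfin phi_bij iota_units iotaM iota_inj iota_ord iota_val ratX
  CP constants psi0 psiE.
exists sigma; split=> // tau tauE.
apply: (extension_unique properX smoothX curveX EXcl EXfin ratX) => f fU.
by rewrite tauE // sigmaE.
Qed.
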